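(* Let $M>0$, $\delta\in(0,1)$, let $\mathcal{J}=\{J:\|J\|_\infty\le M\}$ be the set of all $n\times n$ interaction matrices of infinity norm at most $M$, and assume that $\ell\ge1$ independent samples from $\Pr_{J^*}$, where $J^*\in\mathcal{J}$, are obtained. Then there is a polynomial time algorithm that finds $\hat J\in\mathcal{J}$ such that, with probability at least $1-\delta$, $$\|\hat J-J^*\|_F\le C(M)\sqrt{\frac{n^2\log(n\ell)+\log(1/\delta)}{\ell}},$$ where $C(M)$ is a (singly) exponential function of $M$.
   Context: An interaction matrix is a real symmetric $n\times n$ matrix $J$ with zero diagonal. The Ising model $\Pr_J$ is the distribution on $\{\pm1\}^n$ with $\Pr_J[x]\propto\exp(x^\top Jx/2)$. $\|J\|_\infty=\max_i\sum_j|J_{ij}|$ and $\|\cdot\|_F$ is the Frobenius norm. ''Singly exponential'' means bounded by $ae^{bM}$ for universal constants $a,b>0$. *)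

(* Defs.v *)
From HB Require Import structures.
From mathcomp Require Import all_boot all_order all_algebra.
From mathcomp Require Import reals sequences exp.
Set Implicit Arguments.
Unset Strict Implicit.
Unset Printing Implicit Defensive.
Import Order.TTheory GRing.Theory Num.Theory.
Local Open Scope ring_scope.

(** * Ising models *)

Section Ising.
Variable R : realType.

Definition interaction_matrix n (J : 'M[R]_n) : Prop :=
  J^T = J /\ (forall i, J i i = 0).

Definition infnorm n (A : 'M[R]_n) : R :=
  \big[Num.max/0]_(i < n) \sum_(j < n) `|A i j|.

Definition frobenius n (A : 'M[R]_n) : R :=
  Num.sqrt (\sum_(i < n) \sum_(j < n) A i j ^+ 2).

Definition bounded_interaction n (M : R) (J : 'M[R]_n) : Prop :=
  interaction_matrix J /\ infnorm J <= M.

(* A point of {-1, 1}^n is encoded by the booleans "the coordinate is +1". *)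
Definition config (n : nat) := {ffun 'I_n -> bool}.

Definition spin (b : bool) : R := if b then 1 else -1.

Definition spins n (x : config n) : 'cV[R]_n := \col_i spin (x i).

Definition ising_weight n (J : 'M[R]_n) (x : config n) : R :=
  expR (((spins x)^T *m J *m spins x) 0 0 / 2).

Definition ising n (J : 'M[R]_n) (x : config n) : R :=
  ising_weight J x / \sum_(y : config n) ising_weight J y.

(* X t i is the i-th coordinate of the t-th sample. *)
Definition samples (l n : nat) := {ffun 'I_l -> config n}.

Definition iid_ising_prob l n (J : 'M[R]_n) (E : pred (samples l n)) : R :=
  \sum_(X : samples l n | E X) \prod_(t < l) ising J (X t).

Definition singly_exponential (C : R -> R) : Prop :=
  exists a b : R, [/\ 0 < a, 0 < b &
    forall M, 0 < M -> C M <= a * expR (b * M)].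

End Ising.

(** * Real random access machine

Programs act on finitely many natural-number variables and finitely many
two-dimensional unbounded arrays of exact reals.  Each assignment and each
evaluation of a test costs one unit; the expressions in it have a size fixed by
the program.  To keep the unit cost honest, naturals have no multiplication (so
that their bit length grows at most linearly with time), reals have only field
operations and comparisons, no real is converted to a natural (no rounding),
and all literals in a program are naturals. *)

Inductive iexpr :=
| IVar of nat
| ILit of nat
| IAdd of iexpr & iexpr
| ISub of iexpr & iexpr.

Inductive rexpr :=
| RCell of nat & iexpr & iexpr
| ROfNat of iexpr
| RAdd of rexpr & rexpr
| RSub of rexpr & rexpr
| RMul of rexpr & rexpr
| RDiv of rexpr & rexpr.

Inductive test :=
| TLeI of iexpr & iexpr
| TLeR of rexpr & rexpr
| TNot of test.

Inductive prog :=
| PSkip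
| PSetI of nat & iexpr
| PSetR of nat & iexpr & iexpr & rexpr
| PSeq of prog & prog
| PIf of test & prog & prog
| PWhile of test & prog.

Section Semantics.
Variable R : realType.

Record state := State {
  ivar : nat -> nat;
  rcell : nat -> nat -> nat -> R (* array name, row, column *)
}.

(* Subtraction is truncated. *)
Fixpoint ieval (s : state) (e : iexpr) : nat :=
  match e with
  | IVar v => ivar s v
  | ILit k => k
  | IAdd e1 e2 => (ieval s e1 + ieval s e2)%N
  | ISub e1 e2 => (ieval s e1 - ieval s e2)%N
  end.

(* Division by zero returns zero. *)
Fixpoint reval (s : state) (e : rexpr) : R :=
  match e with
  | RCell a i j => rcell s a (ieval s i) (ieval s j)
  | ROfNat i => (ieval s i)%:R
  | RAdd e1 e2 => reval s e1 + reval s e2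
  | RSub e1 e2 => reval s e1 - reval s e2
  | RMul e1 e2 => reval s e1 * reval s e2
  | RDiv e1 e2 => reval s e1 / reval s e2
  end.

Fixpoint teval (s : state) (b : test) : bool :=
  match b with
  | TLeI e1 e2 => (ieval s e1 <= ieval s e2)%N
  | TLeR e1 e2 => reval s e1 <= reval s e2
  | TNot b1 => ~~ teval s b1
  end.

Definition set_ivar (s : state) (v k : nat) : state :=
  State (fun w => if w == v then k else ivar s w) (rcell s).

Definition set_rcell (s : state) (a i j : nat) (r : R) : state :=
  State (ivar s) (fun a' i' j' =>
    if [&& a' == a, i' == i & j' == j] then r else rcell s a' i' j').

(* exec p s t s': started in s, p halts in s' at cost exactly t. *)
Inductive exec : prog -> state -> nat -> state -> Prop :=
| ExecSkip s : exec PSkip s 1 s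
| ExecSetI s v e : exec (PSetI v e) s 1 (set_ivar s v (ieval s e))
| ExecSetR s a i j e :
    exec (PSetR a i j e) s 1
         (set_rcell s a (ieval s i) (ieval s j) (reval s e))
| ExecSeq p q s1 s2 s3 t1 t2 :
    exec p s1 t1 s2 -> exec q s2 t2 s3 -> exec (PSeq p q) s1 (t1 + t2) s3
| ExecIfT b p q s t s' :
    teval s b -> exec p s t s' -> exec (PIf b p q) s t.+1 s'
| ExecIfF b p q s t s' :
    ~~ teval s b -> exec q s t s' -> exec (PIf b p q) s t.+1 s'
| ExecWhileF b p s : ~~ teval s b -> exec (PWhile b p) s 1 s
| ExecWhileT b p s1 s2 s3 t1 t2 :
    teval s1 b -> exec p s1 t1 s2 -> exec (PWhile b p) s2 t2 s3 ->
    exec (PWhile b p) s1 (t1 + t2).+1 s3.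

(* Input: variables 0 and 1 hold n and l, array 0 holds M and delta in its
   first two cells, and array 1 holds the l by n table of samples; everything
   else is zero. *)
Definition input_state n l (M delta : R) (X : samples l n) : state :=
  State
    (fun v => match v with 0%N => n | 1%N => l | _ => 0%N end)
    (fun a p q =>
       match a with
       | 0%N => match p, q with
                | 0%N, 0%N => M
                | 0%N, 1%N => delta
                | _, _ => 0
                end
       | 1%N => match insub p : option 'I_l, insub q : option 'I_n with
                | Some t, Some i => spin R (X t i)
                | _, _ => 0
                end
       | _ => 0
       end).

(* Output: the first n rows and columns of array 2. *)
Definition output n (s : state) : 'M[R]_n := \matrix_(i, j) rcell s 2 i j.

(* p computes the estimator Jhat in time polynomial in n, l, M and
   log (1 / delta), with constants c and k that depend on p only. *)
Definition computes_in_poly_time (p : prog)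
    (Jhat : forall n l : nat, R -> R -> samples l n -> 'M[R]_n) : Prop :=
  exists c k : nat, forall (n l : nat) (M delta : R) (X : samples l n),
    (0 < n)%N -> (0 < l)%N -> 0 < M -> 0 < delta < 1 ->
    exists (t : nat) (s : state),
      [/\ exec p (input_state M delta X) t s,
          output n s = Jhat n l M delta X &
          t%:R <= c%:R * (n%:R + l%:R + M + ln (1 / delta)) ^+ k].

Definition poly_time_computable
    (Jhat : forall n l : nat, R -> R -> samples l n -> 'M[R]_n) : Prop :=
  exists p : prog, computes_in_poly_time p Jhat.

End Semantics.

(* Main.v *)
Require Import Defs.
From mathcomp Require Import all_boot all_order all_algebra.
From mathcomp Require Import reals sequences exp.
From mathcomp Require Import lra ring zify.
Set Implicit Arguments.
Unset Strict Implicit.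
Unset Printing Implicit Defensive.
Import Order.TTheory GRing.Theory Num.Theory.
Local Open Scope ring_scope.

(** Let w_i(x) = x_i - tanh((Jstar x)_i); given the other spins, w_i has mean
    zero under the Ising model of Jstar.  For a candidate B and A = B - Jstar,
    the derivative at B, along A, of the negative log pseudo-likelihood of a
    sample x is, because tanh is increasing with slope at least
    kappa = exp(-6M) in the relevant range, at least minus the contrast

      w . Ax - kappa |Ax|^2.

    A point where these derivatives are small in total thus has a total contrast
    that is not very negative, and it remains to show that the contrast is very
    negative unless A is small, uniformly in A.

    The heart of the proof is [contrast_mgf]: for one sample,
    E exp(lambda contrast) <= exp(- lambda c |A|_F^2), with lambda and c singly
    exponentially small in M.  No high-temperature assumption is involved.
    Writing mu for the Ising distribution, mu w_i changes sign when spin i is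
    flipped, so that E[w_i g] = E[w_i (g - g o flip_i)] / 2, a discrete
    integration by parts.  It is applied to g = v_i exp(lambda Phi), where the
    exponent Phi dominates the contrast and is w . v minus positive multiples
    of |Ax|^2 and |Aw|^2.  The variation of v_i gives a first-order term, and that
    of the exponential gives lambda times squared variations of quadratic
    forms.  A flip of one spin changes x and w by vectors dominated by a column
    of a matrix with bounded row sums; hence the second-order terms are at most
    lambda (|Ax|^2 + |Aw|^2 + |A|_F^2) up to a constant, and are absorbed for a
    small lambda ([Phi_variation], [tilted_pointwise]).  The negative
    first-order term comes from giving up half of -kappa |Ax|^2 by means of
    |Ax|^2 >= 2 s Ax.Aw - s^2 |Aw|^2: this puts -kappa s AAx into v, and the i-th
    entry of AAx changes by 2 x_i |A_i|^2 when spin i flips ([drift_le]).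

    By independence the exponential moments of the l samples multiply.  All rows
    of A are treated jointly, so that a union bound over a grid of candidate
    matrices costs n^2 log(n l) and the term log(1/delta) is merely added to it
    ([uniform_deviation]).

    For the optimisation, [clip] maps a symmetric matrix into the class of
    bounded interaction matrices by rescaling rows and columns.  Descent follows
    the pseudo-likelihood gradient at the clipped iterate, plus a subgradient of
    a penalty on the row norms which pays for the displacement by clipping
    ([ip_direction_ge]); the estimate is the average of the clipped iterates,
    hence lies in the class exactly.  Errors bounded by a function of M are
    harmless against n^2 log(n l), so a fixed step size, n^3 l^2 steps and the
    approximation (1 + 2u/(nl))^(nl) of exp(2u) are accurate enough
    ([average_contrast_ge]).  If n l < 2M this approximation may fail, but then
    the bound holds for every matrix in the class ([small_sample_rate]).

    The estimator is thus a nest of sums, products, quotients and comparisons in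
    which each loop has length n or l.  A small compiler turns such expressions
    into machine programs; its correctness and the polynomial bound on the cost
    are proved once for all expressions ([ccomp_correct],
    [poly_bounded_ccost]). *)

(** * The hyperbolic tangent and its rational approximation *)

Section Scalars.
Variable R : realType.
Implicit Types u v y M : R.

(** This is tanh u. *)
Definition tanhR u : R := 1 - 2 / (expR (2 * u) + 1).

Lemma norm_tanhR_le1 u : `|tanhR u| <= 1.
Proof.
rewrite /tanhR ler_norml; have E0 := expR_gt0 (2 * u).
have : 2 / (expR (2 * u) + 1) <= 2 by rewrite ler_pdivrMr; lra.
have : 0 <= 2 / (expR (2 * u) + 1) by apply: divr_ge0; lra.
by move=> ? ?; apply/andP; split; lra.
Qed.

Lemma tanhR_diff u v :
  tanhR u - tanhR v = 2 * (expR (2 * u) - expR (2 * v)) /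
                      ((expR (2 * u) + 1) * (expR (2 * v) + 1)).
Proof.
rewrite /tanhR; have E0 := expR_gt0 (2 * u); have F0 := expR_gt0 (2 * v).
by field; apply/andP; split; lra.
Qed.

Lemma tanhR_lipschitz u v : `|tanhR u - tanhR v| <= 4 * `|u - v|.
Proof.
wlog uv : u v / v <= u.
  by move=> H; case: (leP v u) => [/H //|/ltW /H]; rewrite distrC [`|v - u|]distrC.
have E0 := expR_gt0 (2 * u); have F0 := expR_gt0 (2 * v).
have FE : expR (2 * v) <= expR (2 * u) by rewrite ler_expR; lra.
rewrite tanhR_diff !ger0_norm; [|lra|by apply: divr_ge0; [lra|apply: mulr_ge0; lra]].
have D : expR (2 * u) - expR (2 * v) <= expR (2 * u) * (2 * (u - v)).
  have := expR_ge1Dx (2 * (v - u)).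
  have -> : expR (2 * (v - u)) = expR (2 * v) / expR (2 * u).
    by rewrite -expRN -expRD; congr expR; ring.
  rewrite ler_pdivlMr //; lra.
rewrite ler_pdivrMr; last by apply: mulr_gt0; lra.
have : 0 <= (u - v) * expR (2 * v) by apply: mulr_ge0; lra.
have : 0 <= (u - v) * (expR (2 * u) * expR (2 * v)).
  by apply: mulr_ge0; [lra|apply: mulr_ge0; lra].
lra.
Qed.

(** The slope of tanh on [-M, M] is at least exp (-2M); the exponent 6 leaves
    room for a crude estimate. *)
Lemma tanhR_monotone M u v : `|u| <= M -> `|v| <= M ->
  expR (- (6 * M)) * (v - u) ^+ 2 <= (tanhR v - tanhR u) * (v - u).
Proof.
wlog uv : u v / u <= v.
  move=> H hu hv; case: (leP u v) => [uv|/ltW vu]; first exact: H.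
  by have := H _ _ vu hv hu; rewrite -[u - v]opprB sqrrN -[tanhR u - _]opprB mulrNN.
rewrite !ler_norml => /andP[u1 u2] /andP[v1 v2].
have E0 := expR_gt0 (2 * u); have F0 := expR_gt0 (2 * v).
rewrite tanhR_diff.
have D : expR (2 * u) * (2 * (v - u)) <= expR (2 * v) - expR (2 * u).
  have := expR_ge1Dx (2 * (v - u)).
  have -> : expR (2 * (v - u)) = expR (2 * v) / expR (2 * u).
    by rewrite -expRN -expRD; congr expR; ring.
  rewrite ler_pdivlMr //; lra.
have B : (expR (2 * v) + 1) * (expR (2 * u) + 1) <= 4 * expR (4 * M).
  have -> : 4 * expR (4 * M) = (2 * expR (2 * M)) * (2 * expR (2 * M)).
    by rewrite mulrACA -expRD; congr (_ * expR _); ring.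
  have M1 : 1 <= expR (2 * M) by rewrite -[leLHS]expR0 ler_expR; lra.
  have M2 : expR (2 * u) <= expR (2 * M) by rewrite ler_expR; lra.
  have M3 : expR (2 * v) <= expR (2 * M) by rewrite ler_expR; lra.
  by apply: ler_pM; lra.
have G : expR (- (2 * M)) <= expR (2 * u) by rewrite ler_expR; lra.
set P := (_ + 1) * _ in B *.
have P0 : 0 < P by apply: mulr_gt0; lra.
rewrite [leRHS]mulrAC ler_pdivlMr //.
have t0 : 0 <= v - u by lra.
have t2 : 0 <= (v - u) ^+ 2 by exact: sqr_ge0.
have M0' := expR_gt0 (- (6 * M)).
have H : expR (- (6 * M)) * P <= 4 * expR (2 * u).
  have -> : 4 * expR (2 * u) = expR (- (6 * M)) * (4 * (expR (6 * M) * expR (2 * u))).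
    by rewrite expRN; field; rewrite gt_eqF ?expR_gt0.
  apply: ler_wpM2l; first exact: ltW.
  apply: le_trans B _; rewrite ler_wpM2l // -expRD ler_expR; lra.
have {}H := ler_wpM2r t2 H.
have : expR (2 * u) * (2 * (v - u)) * (2 * (v - u)) <=
  (expR (2 * v) - expR (2 * u)) * (2 * (v - u)).
  by apply: ler_wpM2r => //; lra.
lra.
Qed.

(** The exponential exp (2u) in [tanhR] is replaced by the K-th power of
    1 + 2u / K, which needs field operations only. *)
Definition tanh_approx (K : nat) u : R := 1 - 2 / ((1 + 2 * u / K%:R) ^+ K + 1).

(** Both bounds come from 1 + z <= e^z with z = y / K: used at z it gives the
    upper one; used at - z it gives (1 + z) e^(-z) >= 1 - z^2, whose K-th power
    is bounded below by Bernoulli's inequality. *)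
Lemma expR_approx (K : nat) y : (0 < K)%N -> `|y| <= K%:R ->
  expR y * (1 - y ^+ 2 / K%:R) <= (1 + y / K%:R) ^+ K <= expR y.
Proof.
move=> K0 yK; have K0' : 0 < K%:R :> R by rewrite ltr0n.
set z := y / K%:R.
have zE : y = K%:R * z by rewrite mulrC divfK ?gt_eqF.
have /andP[z1 z2] : -1 <= z <= 1.
  by rewrite -ler_norml normrM normfV (gtr0_norm K0') ler_pdivrMr // mul1r.
have z0 : 0 <= 1 + z by lra.
have -> : expR y = expR z ^+ K by rewrite zE expRM_natl.
apply/andP; split; last by apply: lerXn2r; rewrite ?nnegrE ?expR_ge0 ?expR_ge1Dx.
have -> : y ^+ 2 / K%:R = K%:R * z ^+ 2.
  by rewrite zE; field; rewrite gt_eqF.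
have zz : z ^+ 2 <= 1.
  have : 0 <= (1 - z) * (1 + z) by apply: mulr_ge0; lra.
  lra.
have bern : forall m : nat, 1 - m%:R * z ^+ 2 <= (1 - z ^+ 2) ^+ m.
  elim=> [|m IH]; first by rewrite expr0; lra.
  rewrite [leRHS]exprS; have q2 := sqr_ge0 z.
  have : (1 - z ^+ 2) * (1 - m%:R * z ^+ 2) <= (1 - z ^+ 2) * (1 - z ^+ 2) ^+ m.
    by apply: ler_wpM2l => //; lra.
  move=> h; apply: (le_trans _ h); rewrite -natr1.
  have : 0 <= m%:R * z ^+ 2 * z ^+ 2 by apply: mulr_ge0 => //; apply: mulr_ge0 => //; rewrite ler0n.
  lra.
apply: le_trans (ler_wpM2l _ (bern K)) _; first by rewrite exprn_ge0 ?expR_ge0.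
rewrite -exprMn.
have H : expR z * (1 - z ^+ 2) <= 1 + z.
  have := expR_ge1Dx (- z) => h.
  have : (1 + z) * (1 - z) <= (1 + z) * expR (- z) by apply: ler_wpM2l.
  rewrite expRN ler_pdivlMr ?expR_gt0 //; lra.
apply: lerXn2r => //; rewrite nnegrE //.
apply: mulr_ge0; first exact: expR_ge0.
by rewrite subr_ge0.
Qed.

Lemma tanh_approx_base_ge0 (K : nat) u : (0 < K)%N -> `|2 * u| <= K%:R ->
  0 <= (1 + 2 * u / K%:R) ^+ K.
Proof.
move=> K0 uK; have K0' : 0 < K%:R :> R by rewrite ltr0n.
apply: exprn_ge0; move: uK; rewrite ler_norml => /andP[h _].
have : - K%:R / K%:R <= 2 * u / K%:R by rewrite ler_pM2r ?invr_gt0.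
by rewrite mulNr divff ?gt_eqF //; lra.
Qed.

Lemma norm_tanh_approx_le1 (K : nat) u : (0 < K)%N -> `|2 * u| <= K%:R ->
  `|tanh_approx K u| <= 1.
Proof.
move=> K0 uK; have := tanh_approx_base_ge0 K0 uK.
rewrite /tanh_approx; set E := _ ^+ K => E0; rewrite ler_norml.
have : 2 / (E + 1) <= 2 by rewrite ler_pdivrMr; lra.
have : 0 <= 2 / (E + 1) by apply: divr_ge0; lra.
by move=> ? ?; apply/andP; split; lra.
Qed.

Lemma tanh_approx_error (K : nat) u : (0 < K)%N -> `|2 * u| <= K%:R ->
  `|tanh_approx K u - tanhR u| <= 8 * u ^+ 2 / K%:R.
Proof.
move=> K0 uK; have K0' : 0 < K%:R :> R by rewrite ltr0n.
have /andP[] := expR_approx K0 uK; have := tanh_approx_base_ge0 K0 uK.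
rewrite /tanh_approx /tanhR.
set E := expR _; set F := _ ^+ K => F0 FE1 FE2.
have E0 : 0 < E := expR_gt0 _.
have -> : 1 - 2 / (F + 1) - (1 - 2 / (E + 1)) = - (2 * (E - F) / ((F + 1) * (E + 1))).
  by field; apply/andP; split; lra.
rewrite normrN ger0_norm; last by apply: divr_ge0; [lra|apply: mulr_ge0; lra].
rewrite ler_pdivrMr; last by apply: mulr_gt0; lra.
set q := 8 * u ^+ 2 / K%:R.
have q0 : 0 <= q by rewrite divr_ge0 ?ler0n // mulr_ge0 ?sqr_ge0.
have qE : (2 * u) ^+ 2 / K%:R = q / 2 by rewrite /q; field; rewrite gt_eqF.
rewrite qE in FE1.
have : 0 <= q * F by apply: mulr_ge0.
have : 0 <= q * (F * E) by apply: mulr_ge0 => //; apply: mulr_ge0 => //; apply: ltW.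
lra.
Qed.

End Scalars.

(** * Weighted sums and symmetric matrices *)

Section SumInequalities.
Variable R : realType.

Lemma weighted_cauchy_schwarz (I : finType) (p y : I -> R) :
  (forall i, 0 <= p i) ->
  (\sum_i p i * y i) ^+ 2 <= (\sum_i p i) * (\sum_i p i * y i ^+ 2).
Proof.
move=> p0; set S := \sum_i p i; set T := \sum_i p i * y i.
set U := \sum_i p i * y i ^+ 2.
have S0 : 0 <= S by apply: sumr_ge0.
have V0 : 0 <= \sum_i p i * (S * y i - T) ^+ 2.
  by apply: sumr_ge0 => i _; apply: mulr_ge0 => //; apply: sqr_ge0.
have VE : \sum_i p i * (S * y i - T) ^+ 2 = S * (S * U - T ^+ 2).
  have -> : \sum_i p i * (S * y i - T) ^+ 2 =
    \sum_i (S ^+ 2 * (p i * y i ^+ 2) + (- (2 * S * T)) * (p i * y i) + T ^+ 2 * p i).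
    by apply: eq_bigr => i _; ring.
  by rewrite !big_split /= -!mulr_sumr -/S -/T -/U; ring.
move: S0; rewrite le_eqVlt => /orP[/eqP S0|S0]; last first.
  by rewrite -subr_ge0 -(pmulr_rge0 _ S0) -VE.
have pz i : p i = 0.
  have := S0; rewrite /S => /esym/eqP.
  by rewrite psumr_eq0 // => /allP/(_ i (mem_index_enum i))/eqP.
have -> : T = 0 by rewrite /T big1 // => i _; rewrite pz mul0r.
by rewrite -S0 mul0r expr0n.
Qed.

Lemma ler_sqr_norm (a b : R) : `|a| <= b -> a ^+ 2 <= b ^+ 2.
Proof.
move=> h; rewrite -real_normK ?num_real //; apply: lerXn2r => //; rewrite nnegrE //.
by apply: le_trans h.
Qed.

Variable n : nat.
Implicit Types (B K A : 'M[R]_n) (y z u v : 'I_n -> R) (k : R).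

Lemma subr_mxE A B i j : (A - B) i j = A i j - B i j.
Proof. by rewrite !mxE. Qed.

Definition mv B z : 'I_n -> R := fun i => \sum_j B i j * z j.
Definition dot u v : R := \sum_i u i * v i.
Definition sqn v : R := \sum_i v i ^+ 2.
Definition frob2 B : R := \sum_i \sum_j B i j ^+ 2.
Definition rows_le k B := forall i, \sum_j `|B i j| <= k.
Definition symm B := forall i j, B i j = B j i.

Lemma sqn_ge0 v : 0 <= sqn v.
Proof. by apply: sumr_ge0 => i _; apply: sqr_ge0. Qed.

Lemma frob2_ge0 B : 0 <= frob2 B.
Proof. by apply: sumr_ge0 => i _; apply: sumr_ge0 => j _; apply: sqr_ge0. Qed.

Lemma entry_le_rows k B : rows_le k B -> forall i j, `|B i j| <= k.
Proof.
move=> h i j; apply: le_trans (h i).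
by rewrite (bigD1 j) //= lerDl; apply: sumr_ge0.
Qed.

(** Schur's test: row sums at most k and symmetry bound the operator norm of the
    entrywise absolute value by k. *)
Lemma schur_abs k K y : symm K -> rows_le k K ->
  \sum_i (\sum_j `|K i j| * `|y j|) ^+ 2 <= k ^+ 2 * sqn y.
Proof.
move=> Ks Kk; have [->|/eqP n0] := eqVneq (\sum_i (\sum_j `|K i j| * `|y j|) ^+ 2) 0.
  by rewrite mulr_ge0 ?sqr_ge0 ?sqn_ge0.
have k0 : 0 <= k.
  rewrite leNgt; apply/negP => kn; apply: n0; apply: big1 => i _.
  by have := le_trans (sumr_ge0 _ (fun j _ => normr_ge0 (K i j))) (Kk i); rewrite leNgt kn.
have h1 i : (\sum_j `|K i j| * `|y j|) ^+ 2 <= k * \sum_j `|K i j| * y j ^+ 2.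
  apply: le_trans (weighted_cauchy_schwarz (fun j => `|y j|) (fun j => normr_ge0 (K i j))) _.
  under [X in _ * X <= _]eq_bigr do rewrite real_normK ?num_real //.
  apply: ler_wpM2r (Kk i); apply: sumr_ge0 => j _.
  by rewrite mulr_ge0 ?sqr_ge0.
apply: le_trans (ler_sum _ (fun i _ => h1 i)) _.
rewrite -mulr_sumr exchange_big /= expr2 -mulrA; apply: ler_wpM2l => //.
rewrite /sqn mulr_sumr; apply: ler_sum => j _; rewrite -mulr_suml.
apply: ler_wpM2r; first exact: sqr_ge0.
by under eq_bigr do rewrite Ks; apply: Kk.
Qed.

Lemma norm_mv_le B y i : `|mv B y i| <= \sum_j `|B i j| * `|y j|.
Proof.
apply: le_trans (ler_norm_sum _ _ _) _.
by apply: ler_sum => j _; rewrite normrM.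
Qed.

Lemma sqn_mv_le k B y : symm B -> rows_le k B -> sqn (mv B y) <= k ^+ 2 * sqn y.
Proof.
move=> Bs Bk; apply: le_trans (schur_abs y Bs Bk).
by apply: ler_sum => i _; apply: ler_sqr_norm; apply: norm_mv_le.
Qed.

Lemma symm_mulmx A : symm A -> symm (A *m A).
Proof.
by move=> As i j; rewrite !mxE; apply: eq_bigr => l _; rewrite mulrC As [X in _ * X]As.
Qed.

Lemma mv_mulmx A y i : mv (A *m A) y i = mv A (mv A y) i.
Proof.
rewrite /mv; under eq_bigr do rewrite mxE mulr_suml.
rewrite exchange_big /=; apply: eq_bigr => l _; rewrite mulr_sumr.
by apply: eq_bigr => j _; rewrite mulrA.
Qed.

Lemma frob2_mulmx_le k A : symm A -> rows_le k A ->
  frob2 (A *m A) <= k ^+ 2 * frob2 A.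
Proof.
move=> As Ak; rewrite /frob2 exchange_big [X in _ * X]exchange_big /= mulr_sumr.
apply: ler_sum => j _.
have := sqn_mv_le (fun l => A l j) As Ak.
by apply: le_trans; apply: ler_sum => i _; rewrite mxE.
Qed.

Lemma mulmx_diag A i : symm A -> (A *m A) i i = \sum_j A i j ^+ 2.
Proof. by move=> As; rewrite mxE; apply: eq_bigr => j _; rewrite [A j i]As expr2. Qed.

(** G = AA is positive semidefinite, so |G_ij| is at most the mean of G_ii and
    G_jj, and the trace of G is |A|_F^2.  A bound by |A|_F^2 with no square root
    is what lets the drift term dominate. *)
Lemma gram_weight_le k A K : symm A -> symm K -> rows_le k K ->
  \sum_i \sum_j `|(A *m A) i j| * `|K i j| <= k * frob2 A.
Proof.
move=> As Ks Kk.
have h i j : `|(A *m A) i j| <= (\sum_l A i l ^+ 2 + \sum_l A j l ^+ 2) / 2.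
  rewrite mxE -big_split /= mulr_suml; apply: le_trans (ler_norm_sum _ _ _) _.
  apply: ler_sum => l _; rewrite [A l j]As normrM ler_pdivlMr //.
  have := sqr_ge0 (`|A i l| - `|A j l|).
  rewrite -[A i l ^+ 2]real_normK ?num_real // -[A j l ^+ 2]real_normK ?num_real //; lra.
have -> : k * frob2 A = \sum_i (k * \sum_l A i l ^+ 2 / 2 + k * \sum_l A i l ^+ 2 / 2).
  by rewrite mulr_sumr; apply: eq_bigr => i _; rewrite -mulr_suml; field.
apply: (@le_trans _ _ (\sum_i \sum_j ((\sum_l A i l ^+ 2 / 2) * `|K i j| +
   (\sum_l A j l ^+ 2 / 2) * `|K i j|))).
  apply: ler_sum => i _; apply: ler_sum => j _; rewrite -mulrDl.
  by apply: ler_wpM2r => //; rewrite -!mulr_suml -mulrDl.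
under eq_bigr do rewrite big_split.
rewrite !big_split /=; apply: lerD; last rewrite exchange_big /=;
  apply: ler_sum => i _; rewrite -mulr_sumr mulrC;
  (apply: ler_wpM2r; first by apply: sumr_ge0 => l _; rewrite divr_ge0 ?sqr_ge0).
  exact: Kk.
by under eq_bigr do rewrite Ks; apply: Kk.
Qed.

Lemma diag_weight_le k B K : rows_le k K ->
  \sum_i (\sum_j `|B i j| * `|K i j|) ^+ 2 <= k ^+ 2 * frob2 B.
Proof.
move=> Kk; rewrite mulr_sumr; apply: ler_sum => i _.
under eq_bigr do rewrite mulrC.
apply: le_trans (weighted_cauchy_schwarz (fun j => `|B i j|) (fun j => normr_ge0 (K i j))) _.
have s0 : 0 <= \sum_j `|K i j| by apply: sumr_ge0.
rewrite expr2 -mulrA; apply: ler_pM => //.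
  by apply: sumr_ge0 => j _; rewrite mulr_ge0 ?sqr_ge0.
rewrite mulr_sumr; apply: ler_sum => j _; rewrite real_normK ?num_real //.
by apply: ler_wpM2r; [apply: sqr_ge0|apply: entry_le_rows].
Qed.

Lemma pair_weight_le k B K : symm K -> rows_le k K ->
  \sum_i (\sum_j \sum_l `|K i j| * `|B j l| * `|K i l|) ^+ 2 <= k ^+ 4 * frob2 B.
Proof.
move=> Ks Kk.
have Kij := entry_le_rows Kk.
have s0 i : 0 <= \sum_j `|K i j| by apply: sumr_ge0.
have h i : (\sum_j \sum_l `|K i j| * `|B j l| * `|K i l|) ^+ 2 <=
    k ^+ 2 * \sum_j \sum_l `|K i j| * `|K i l| * B j l ^+ 2.
  rewrite !pair_bigA /=.
  rewrite (eq_bigr (fun p : 'I_n * 'I_n => (`|K i p.1| * `|K i p.2|) * `|B p.1 p.2|)); last first.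
    by move=> p _; rewrite mulrAC.
  apply: le_trans (weighted_cauchy_schwarz _ _) _.
    by move=> p; rewrite mulr_ge0.
  under [X in _ * X <= _]eq_bigr do rewrite real_normK ?num_real //.
  apply: ler_wpM2r; first by apply: sumr_ge0 => p _; rewrite mulr_ge0 ?sqr_ge0 ?mulr_ge0.
  rewrite -(pair_bigA _ (fun j l => `|K i j| * `|K i l|)) /=.
  under eq_bigr do rewrite -mulr_sumr.
  by rewrite -mulr_suml expr2; apply: ler_pM.
apply: le_trans (ler_sum _ (fun i _ => h i)) _.
rewrite -mulr_sumr (exprD k 2 2) -mulrA; apply: ler_wpM2l; first exact: sqr_ge0.
rewrite exchange_big /= mulr_sumr; apply: ler_sum => j _.
rewrite exchange_big /= mulr_sumr; apply: ler_sum => l _.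
rewrite -mulr_suml; apply: ler_wpM2r; first exact: sqr_ge0.
have k0 : 0 <= k by apply: le_trans (Kij j j).
apply: (@le_trans _ _ (\sum_i `|K j i| * k)).
  by apply: ler_sum => i _; rewrite [K i j]Ks; apply: ler_wpM2l.
by rewrite -mulr_suml expr2; apply: ler_wpM2r.
Qed.

End SumInequalities.

(** * Single-spin flips of the Ising model *)

Section Forms.
Variables (R : realType) (n : nat).
Implicit Types (B K A J : 'M[R]_n) (y z u v : 'I_n -> R) (k : R).

Lemma dotC u v : dot u v = dot v u.
Proof. by apply: eq_bigr => i _; rewrite mulrC. Qed.

Lemma dot_mvC B u v : symm B -> dot u (mv B v) = dot v (mv B u).
Proof.
move=> Bs; rewrite /dot /mv.
under eq_bigr do rewrite mulr_sumr.
rewrite exchange_big /=; apply: eq_bigr => j _; rewrite mulr_sumr.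
by apply: eq_bigr => i _; rewrite Bs; ring.
Qed.

Lemma dot_mv_mulmx A u v : symm A -> dot u (mv (A *m A) v) = dot (mv A u) (mv A v).
Proof.
move=> As; rewrite [RHS]dotC -[RHS]dot_mvC //.
by apply: eq_bigr => i _; rewrite mv_mulmx.
Qed.

Lemma dot_sqn v : dot v v = sqn v.
Proof. by apply: eq_bigr => i _; rewrite expr2. Qed.

Lemma mv_sub B u v i : mv B (fun j => u j - v j) i = mv B u i - mv B v i.
Proof. by rewrite /mv -sumrB; apply: eq_bigr => j _; rewrite mulrBr. Qed.

Lemma form_sub B z z' u u' : symm B ->
  dot z (mv B z') - dot u (mv B u') =
  dot (fun j => z j - u j) (mv B z') + dot (fun j => z' j - u' j) (mv B z)
  - dot (fun j => z j - u j) (mv B (fun j => z' j - u' j)).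
Proof.
move=> Bs.
have -> : dot (fun j => z' j - u' j) (mv B z) = dot z (mv B z') - dot z (mv B u').
  rewrite dot_mvC // /dot -sumrB; apply: eq_bigr => i _.
  by rewrite mv_sub mulrBr.
rewrite /dot -!sumrB -big_split /= -sumrB; apply: eq_bigr => i _.
by rewrite mv_sub; ring.
Qed.

Lemma sqr_add3 (a b c : R) : (a + b + c) ^+ 2 <= 3 * (a ^+ 2 + b ^+ 2 + c ^+ 2).
Proof.
have := sqr_ge0 (a - b); have := sqr_ge0 (b - c); have := sqr_ge0 (a - c); lra.
Qed.

Lemma sqr_add4 (a b c d : R) :
  (a + b + c + d) ^+ 2 <= 4 * (a ^+ 2 + b ^+ 2 + c ^+ 2 + d ^+ 2).
Proof.
have := sqr_ge0 (a - b); have := sqr_ge0 (b - c); have := sqr_ge0 (a - c).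
have := sqr_ge0 (a - d); have := sqr_ge0 (b - d); have := sqr_ge0 (c - d); lra.
Qed.

End Forms.

Section Flip.
Variables (R : realType) (n : nat).
Implicit Types (x : config n) (i j : 'I_n).

Definition flip i x : config n := [ffun j => if j == i then ~~ x j else x j].

Lemma flipK i : involutive (flip i).
Proof.
by move=> x; apply/ffunP => j; rewrite !ffunE; case: eqP => // _; rewrite negbK.
Qed.

Definition sx x : 'I_n -> R := fun i => spin R (x i).

Lemma sxE x i : spins R x i 0 = sx x i.
Proof. by rewrite mxE. Qed.

Lemma norm_sx x i : `|sx x i| = 1.
Proof. by rewrite /sx /spin; case: (x i); rewrite ?normrN normr1. Qed.

Lemma sx_flip i x j : sx (flip i x) j = if j == i then - sx x j else sx x j.
Proof. by rewrite /sx ffunE; case: eqP => // _; rewrite /spin; case: (x j) => /=; ring. Qed.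

Lemma sx_flip_diff i x j : sx x j - sx (flip i x) j = (j == i)%:R * (2 * sx x i).
Proof. by rewrite sx_flip; case: eqP => [->|_] /=; ring. Qed.

Lemma mv_flip_diff (B : 'M[R]_n) i x j :
  mv B (sx x) j - mv B (sx (flip i x)) j = B j i * (2 * sx x i).
Proof.
rewrite -mv_sub /mv (bigD1 i) //= big1 ?addr0.
  by rewrite sx_flip_diff eqxx mul1r.
by move=> l /negbTE li; rewrite sx_flip_diff li mul0r mulr0.
Qed.

Lemma norm_mv_sx_le (B : 'M[R]_n) k x i : rows_le k B -> `|mv B (sx x) i| <= k.
Proof.
move=> Bk; apply: le_trans (norm_mv_le _ _ _) _.
by under eq_bigr do rewrite norm_sx mulr1; apply: Bk.
Qed.

End Flip.

Section IsingIdentities.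
Variables (R : realType) (n : nat) (J : 'M[R]_n).
Hypotheses (Js : symm J) (Jd : forall i, J i i = 0).
Implicit Types (x : config n) (i j : 'I_n).

(** The deviation of each spin from its conditional mean. *)
Definition resid x : 'I_n -> R := fun i => sx R x i - tanhR (mv J (sx R x) i).

Lemma ising_weightE x : ising_weight J x = expR (dot (sx R x) (mv J (sx R x)) / 2).
Proof.
rewrite /ising_weight; congr (expR (_ / 2)).
rewrite mxE; under eq_bigr => j _ do rewrite mxE sxE mulr_suml.
rewrite exchange_big /=; apply: eq_bigr => i _; rewrite mulr_sumr.
by apply: eq_bigr => j _; rewrite mxE sxE mulrA.
Qed.

Lemma field_flip i x : mv J (sx R (flip i x)) i = mv J (sx R x) i.
Proof. by have := mv_flip_diff J i x i; rewrite Jd mul0r => /subr0_eq ->. Qed.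

Lemma ising_weight_flip i x :
  ising_weight J (flip i x) =
  ising_weight J x * expR (- (2 * sx R x i * mv J (sx R x) i)).
Proof.
rewrite !ising_weightE -expRD; congr expR.
have := form_sub (sx R x) (sx R x) (sx R (flip i x)) (sx R (flip i x)) Js.
have D u : dot (fun j => sx R x j - sx R (flip i x) j) u = 2 * sx R x i * u i.
  rewrite /dot (bigD1 i) //= big1 ?addr0; first by rewrite sx_flip_diff eqxx mul1r.
  by move=> l /negbTE li; rewrite sx_flip_diff li !mul0r.
rewrite !D mv_sub field_flip subrr mulr0 subr0; lra.
Qed.

(** Given the other spins, x_i has mean tanh of its local field; this is the
    detailed-balance form of that fact. *)
Lemma ising_weight_resid_flip i x :
  ising_weight J (flip i x) * resid (flip i x) i = - (ising_weight J x * resid x i).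
Proof.
rewrite ising_weight_flip -mulrA -[RHS]mulrN; congr (_ * _).
rewrite /resid field_flip sx_flip eqxx /tanhR; set h := mv _ _ _.
have E0 := expR_gt0 (2 * h).
rewrite /sx /spin; case: (x i).
  have -> : - (2 * 1 * h) = - (2 * h) by ring.
  by rewrite expRN; field; apply/andP; split; lra.
have -> : - (2 * -1 * h) = 2 * h by ring.
by field; lra.
Qed.

Lemma partition_gt0 : 0 < \sum_(y : config n) ising_weight J y.
Proof.
rewrite (bigD1 [ffun=> true]) //=; apply: ltr_pwDl; first exact: expR_gt0.
by apply: sumr_ge0 => x _; apply: expR_ge0.
Qed.

Lemma ising_ge0 x : 0 <= ising J x.
Proof. by rewrite divr_ge0 ?expR_ge0 // ltW // partition_gt0. Qed.

Lemma ising_sum1 : \sum_x ising J x = 1.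
Proof. by rewrite -mulr_suml divff // gt_eqF // partition_gt0. Qed.

Lemma ising_resid_flip i x :
  ising J (flip i x) * resid (flip i x) i = - (ising J x * resid x i).
Proof. by rewrite /ising mulrAC ising_weight_resid_flip mulNr -mulrAC. Qed.

Definition expect (f : config n -> R) : R := \sum_x ising J x * f x.

Lemma ler_expect f g : (forall x, f x <= g x) -> expect f <= expect g.
Proof. by move=> h; apply: ler_sum => x _; apply: ler_wpM2l (h x); apply: ising_ge0. Qed.

Lemma eq_expect f g : f =1 g -> expect f = expect g.
Proof. by move=> h; apply: eq_bigr => x _; rewrite h. Qed.

Lemma expect_sum (I : finType) (f : I -> config n -> R) :
  expect (fun x => \sum_i f i x) = \sum_i expect (f i).
Proof. by rewrite /expect exchange_big; apply: eq_bigr => x _; rewrite mulr_sumr. Qed.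

Lemma expectD f g : expect (fun x => f x + g x) = expect f + expect g.
Proof. by rewrite -big_split; apply: eq_bigr => x _; rewrite mulrDr. Qed.

Lemma expectZ c f : expect (fun x => c * f x) = c * expect f.
Proof. by rewrite mulr_sumr; apply: eq_bigr => x _; rewrite mulrCA. Qed.

Lemma expect_cst c : expect (fun=> c) = c.
Proof. by rewrite /expect -mulr_suml ising_sum1 mul1r. Qed.

Lemma expect_resid_flip i (f : config n -> R) :
  expect (fun x => resid x i * f (flip i x)) = - expect (fun x => resid x i * f x).
Proof.
rewrite /expect (reindex_inj (inv_inj (flipK i))) /= -sumrN.
by apply: eq_bigr => x _; rewrite flipK !mulrA ising_resid_flip mulNr.
Qed.

Lemma expect_norm_resid_flip i (f : config n -> R) :
  expect (fun x => `|resid x i| * f (flip i x)) = expect (fun x => `|resid x i| * f x).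
Proof.
rewrite /expect (reindex_inj (inv_inj (flipK i))) /=.
apply: eq_bigr => x _; rewrite flipK !mulrA; congr (_ * _).
by rewrite -(ger0_norm (ising_ge0 (flip i x))) -(ger0_norm (ising_ge0 x)) -!normrM
           ising_resid_flip normrN.
Qed.

Lemma norm_resid_le2 x i : `|resid x i| <= 2.
Proof.
have := ler_normB (sx R x i) (tanhR (mv J (sx R x) i)); rewrite norm_sx.
have := norm_tanhR_le1 (mv J (sx R x) i); rewrite /resid; lra.
Qed.

Lemma norm_expR_sub (a b : R) : `|expR a - expR b| <= `|a - b| * (expR a + expR b).
Proof.
wlog ab : a b / b <= a.
  move=> H; case: (leP b a) => [/H //|/ltW /H].
  by rewrite distrC [`|b - a|]distrC [X in _ <= _ * X]addrC.
have F0 := expR_gt0 b; have E0 := expR_gt0 a.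
have FE : expR b <= expR a by rewrite ler_expR.
rewrite !ger0_norm ?subr_ge0 //.
have := expR_ge1Dx (b - a); rewrite expRD expRN => h.
have : (1 + (b - a)) * expR a <= expR b.
  by apply: le_trans (ler_wpM2r (ltW E0) h) _; rewrite mulfVK ?gt_eqF.
have : 0 <= (a - b) * expR b by rewrite mulr_ge0 ?subr_ge0 // ltW.
lra.
Qed.

(** Integration by parts against w_i.  The difference of v exp(lam Phi) and its
    flip is split into the two symmetric products (v - v') (e + e') / 2 and
    (v + v') (e - e') / 2.  Since |mu w_i| is invariant under the flip, the
    flipped exponential e' can be traded back for e in both of them, so no
    factor exp(M) is lost. *)
Lemma expect_resid_expR i (v Phi : config n -> R) (lam : R) : 0 <= lam ->
  expect (fun x => resid x i * v x * expR (lam * Phi x)) <=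
  expect (fun x => (resid x i * (v x - v (flip i x)) / 2 +
    lam * (4 * v x ^+ 2 + (v x - v (flip i x)) ^+ 2 +
           (Phi x - Phi (flip i x)) ^+ 2 / 2)) * expR (lam * Phi x)).
Proof.
move=> lam0; set e := fun x => expR (lam * Phi x).
pose dv x := v x - v (flip i x); pose dP x := Phi x - Phi (flip i x).
pose S x := `|v x + v (flip i x)| * `|dP x|.
have e0 x : 0 < e x := expR_gt0 _.
have S0 x : 0 <= S x by rewrite mulr_ge0.
have Sf x : S (flip i x) = S x.
  rewrite /S /dP flipK; congr (`|_| * _); [exact: addrC|exact: distrC].
have dvf x : dv (flip i x) = - dv x by rewrite /dv flipK opprB.
have step : expect (fun x => resid x i * v x * e x) =
  4^-1 * (expect (fun x => resid x i * (dv x * e x)) -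
          expect (fun x => resid x i * (dv (flip i x) * e (flip i x))))
  + 4^-1 * expect (fun x => resid x i * ((v x + v (flip i x)) * (e x - e (flip i x)))).
  rewrite (expect_resid_flip i (fun x => dv x * e x)).
  pose f x := v x * e x; pose g x := v (flip i x) * e x.
  have -> : expect (fun x => resid x i * v x * e x) = expect (fun x => resid x i * f x).
    by apply: eq_expect => x; rewrite mulrA.
  have -> : expect (fun x => resid x i * (dv x * e x)) =
    expect (fun x => resid x i * f x) - expect (fun x => resid x i * g x).
    rewrite -[- expect _]mulN1r -expectZ -expectD; apply: eq_expect => x.
    by rewrite /f /g /dv; ring.
  have -> : expect (fun x => resid x i * ((v x + v (flip i x)) * (e x - e (flip i x)))) =
    expect (fun x => resid x i * f x) + expect (fun x => resid x i * g x)
    - (expect (fun x => resid x i * f (flip i x)) + expect (fun x => resid x i * g (flip i x))).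
    rewrite -!expectD -[- expect _]mulN1r -expectZ -expectD; apply: eq_expect => x.
    by rewrite /f /g flipK; ring.
  by rewrite !expect_resid_flip; field.
have bound2 : expect (fun x => resid x i * ((v x + v (flip i x)) * (e x - e (flip i x)))) <=
    4 * lam * expect (fun x => S x * e x).
  apply: (@le_trans _ _ (expect (fun x => `|resid x i| * (lam * S x * e x) +
     `|resid x i| * (lam * S (flip i x) * e (flip i x))))).
    apply: ler_expect => x; rewrite Sf -mulrDr -mulrDr.
    apply: le_trans (ler_norm _) _; rewrite !normrM; apply: ler_wpM2l => //.
    rewrite /S -mulrA -mulrA mulrCA; apply: ler_wpM2l => //.
    have := norm_expR_sub (lam * Phi x) (lam * Phi (flip i x)).
    by rewrite -mulrBr normrM (ger0_norm lam0) mulrA.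
  rewrite expectD (expect_norm_resid_flip i (fun x => lam * S x * e x)) -expectD -expectZ.
  apply: ler_expect => x.
  have -> : `|resid x i| * (lam * S x * e x) + `|resid x i| * (lam * S x * e x) =
    2 * `|resid x i| * (lam * (S x * e x)) by ring.
  have -> : 4 * lam * (S x * e x) = (2 * 2) * (lam * (S x * e x)) by ring.
  apply: ler_wpM2r; first by rewrite !mulr_ge0 // ltW.
  by rewrite ler_pM2l ?ltr0n // norm_resid_le2.
rewrite -/e step (expect_resid_flip i (fun x => dv x * e x)).
have -> : 4^-1 * (expect (fun x => resid x i * (dv x * e x)) -
   - expect (fun x => resid x i * (dv x * e x))) =
   expect (fun x => resid x i * dv x / 2 * e x).
  have -> : expect (fun x => resid x i * dv x / 2 * e x) =
    2^-1 * expect (fun x => resid x i * (dv x * e x)).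
    by rewrite -expectZ; apply: eq_expect => x; field.
  by field.
apply: (@le_trans _ _ (expect (fun x => resid x i * dv x / 2 * e x) +
   lam * expect (fun x => S x * e x))).
  by rewrite lerD2l ler_pdivrMl // mulrA.
rewrite -expectZ -expectD; apply: ler_expect => x.
rewrite mulrA -mulrDl; apply: ler_wpM2r; first exact: ltW.
rewrite lerD2l; apply: ler_wpM2l => //.
have h1 : v x + v (flip i x) = 2 * v x - dv x by rewrite /dv; ring.
rewrite /S h1 -/(dv x) -/(dP x).
have := sqr_ge0 (`|2 * v x - dv x| - `|dP x|).
have := real_normK (num_real (2 * v x - dv x)).
have := real_normK (num_real (dP x)).
have := sqr_ge0 (2 * v x + dv x).
move: (`|2 * v x - dv x|) (`|dP x|) => p q; lra.
Qed.

End IsingIdentities.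

(** * The exponential moment of the contrast *)

(** mgf_sigma is the parameter s in |Ax|^2 >= 2 s Ax.Aw - s^2 |Aw|^2.  It balances
    the drift kappa s exp(-2M) |A|_F^2 against the error kappa s^2 k |A|_F^2,
    where k = 2 + 8M bounds the influence of a spin; mgf_lambda then makes the
    second-order terms, of order k^6, smaller than kappa s^2. *)
Definition mgf_sigma (R : realType) (M : R) : R :=
  expR (- (2 * M)) / (2 * (2 + 8 * M)).
Definition mgf_lambda (R : realType) (M kappa : R) : R :=
  kappa * mgf_sigma M ^+ 2 / (132 * (2 + 8 * M) ^+ 6).
Definition mgf_rate (R : realType) (M kappa : R) : R :=
  kappa * mgf_sigma M * expR (- (2 * M)) / 4.

Section ContrastMgf.
Variables (R : realType) (n : nat) (J A : 'M[R]_n) (M kappa : R).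
Hypotheses (Js : symm J) (Jd : forall i, J i i = 0) (JM : rows_le M J).
Hypotheses (As : symm A) (Ad : forall i, A i i = 0) (AM : rows_le (2 * M) A).
Hypotheses (M0 : 0 <= M) (kappa0 : 0 < kappa) (kappa1 : kappa <= 1).
Implicit Types (x : config n) (i j : 'I_n).

Let w := resid J.
Let s := @sx R n.
Let G := A *m A.
Let k : R := 2 + 8 * M.
Let tau := frob2 A.

(** A flip of spin i moves x_j by at most 2 (i == j) and, as [tanhR] is
    4-Lipschitz, w_j by at most 8 |J_ij| more. *)
Definition influence : 'M[R]_n := \matrix_(i, j) (2 * (i == j)%:R + 8 * `|J i j|).

Lemma influence_ge0 i j : 0 <= influence i j.
Proof. by rewrite mxE addr_ge0 ?mulr_ge0 ?ler0n. Qed.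

Lemma influence_symm : symm influence.
Proof. by move=> i j; rewrite !mxE eq_sym Js. Qed.

Lemma influence_rows : rows_le k influence.
Proof.
move=> i; under eq_bigr do rewrite ger0_norm ?influence_ge0 // mxE.
rewrite big_split /= -!mulr_sumr (bigD1 i) //= eqxx big1 ?addr0 ?mulr1.
  by rewrite lerD2l; apply: ler_wpM2l (JM i).
by move=> j; rewrite eq_sym => /negbTE ->.
Qed.

Definition controlled (z : config n -> 'I_n -> R) :=
  forall i x j, `|z x j - z (flip i x) j| <= `|influence i j|.

Lemma controlled_sx : controlled s.
Proof.
move=> i x j; rewrite (ger0_norm (influence_ge0 _ _)) /s sx_flip_diff mxE.
rewrite !normrM norm_sx eq_sym normr_nat mulr1 (ger0_norm (ler0n R 2)) mulrC.
by rewrite lerDl mulr_ge0.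
Qed.

Lemma controlled_resid : controlled w.
Proof.
move=> i x j; rewrite (ger0_norm (influence_ge0 _ _)).
have -> : w x j - w (flip i x) j = (s x j - s (flip i x) j) -
    (tanhR (mv J (s x) j) - tanhR (mv J (s (flip i x)) j)) by rewrite /w /resid /s; ring.
apply: le_trans (ler_normB _ _) _; rewrite mxE; apply: lerD.
  by rewrite /s sx_flip_diff !normrM norm_sx eq_sym normr_nat mulr1 (ger0_norm (ler0n R 2)) mulrC.
apply: le_trans (tanhR_lipschitz _ _) _.
rewrite /s mv_flip_diff !normrM norm_sx mulr1 (ger0_norm (ler0n R 2)) Js.
have := normr_ge0 (J i j); lra.
Qed.

(** The variation of a quadratic form has two linear parts, handled by Schur's
    test, and a part quadratic in the displacement. *)
Lemma form_variation B z z' x : symm B -> controlled z -> controlled z' ->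
  \sum_i (dot (z x) (mv B (z' x)) - dot (z (flip i x)) (mv B (z' (flip i x)))) ^+ 2 <=
  3 * (k ^+ 2 * sqn (mv B (z' x)) + k ^+ 2 * sqn (mv B (z x)) + k ^+ 4 * frob2 B).
Proof.
move=> Bs hz hz'.
have Ks := influence_symm; have Kk := influence_rows.
have H := lerD (lerD (schur_abs (mv B (z' x)) Ks Kk) (schur_abs (mv B (z x)) Ks Kk))
  (pair_weight_le B Ks Kk).
apply: (le_trans _ (ler_wpM2l (ler0n R 3) H)).
rewrite -!big_split /= mulr_sumr; apply: ler_sum => i _.
rewrite form_sub //; apply: le_trans (sqr_add3 _ _ _) _.
apply: ler_wpM2l => //; rewrite sqrrN.
have lin (u : config n -> 'I_n -> R) y : controlled u ->
    `|dot (fun j => u x j - u (flip i x) j) y| <= \sum_j `|influence i j| * `|y j|.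
  move=> hu; apply: le_trans (ler_norm_sum _ _ _) _; apply: ler_sum => j _.
  by rewrite normrM; apply: ler_wpM2r => //; apply: hu.
apply: lerD; first apply: lerD.
- by apply: ler_sqr_norm; apply: lin.
- by apply: ler_sqr_norm; apply: lin.
apply: ler_sqr_norm; apply: le_trans (lin _ _ hz) _.
apply: ler_sum => j _; under [leRHS]eq_bigr do rewrite -mulrA.
rewrite -mulr_sumr; apply: ler_wpM2l => //; apply: le_trans (norm_mv_le _ _ _) _.
by apply: ler_sum => l _; apply: ler_wpM2l => //; apply: hz'.
Qed.

Lemma diag_variation B z x i : controlled z ->
  `|mv B (z x) i - mv B (z (flip i x)) i| <= \sum_j `|B i j| * `|influence i j|.
Proof.
move=> hz; rewrite -mv_sub; apply: le_trans (norm_mv_le _ _ _) _.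
by apply: ler_sum => j _; apply: ler_wpM2l => //; apply: hz.
Qed.

Lemma diag_variation_sqr B z x : controlled z ->
  \sum_i (mv B (z x) i - mv B (z (flip i x)) i) ^+ 2 <= k ^+ 2 * frob2 B.
Proof.
move=> hz; apply: le_trans (diag_weight_le B influence_rows).
by apply: ler_sum => i _; apply: ler_sqr_norm; apply: diag_variation.
Qed.

Lemma spin_resid_ge x i : expR (- (2 * M)) <= w x i * s x i.
Proof.
have [h1 h2] : - M <= mv J (s x) i /\ mv J (s x) i <= M.
  by have := norm_mv_sx_le x i JM; rewrite ler_norml => /andP.
rewrite /w /resid /s /tanhR; move: h1 h2; rewrite /s; set h := mv _ _ _ => h1 h2.
have H0 := expR_gt0 (2 * h); have E0 := expR_gt0 (- (2 * M)).
have N1 : expR (- (2 * M)) <= expR (2 * h) by rewrite ler_expR; lra.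
have N2 : expR (2 * h) * expR (- (2 * M)) <= 1.
  by rewrite -expRD -[leRHS]expR0 ler_expR; lra.
have N3 : expR (- (2 * M)) <= 1 by rewrite -[leRHS]expR0 ler_expR; lra.
rewrite /sx /spin; case: (x i).
  have -> : (1 - (1 - 2 / (expR (2 * h) + 1))) * 1 = 2 / (expR (2 * h) + 1) by ring.
  rewrite ler_pdivlMr; lra.
have -> : (-1 - (1 - 2 / (expR (2 * h) + 1))) * -1 = 2 * expR (2 * h) / (expR (2 * h) + 1).
  by field; lra.
rewrite ler_pdivlMr; last lra.
have := ler_wpM2r (ltW H0) N3; lra.
Qed.

Let e0 := expR (- (2 * M)).
Let sg := e0 / (2 * k).
Let a x := mv A (s x).
Let b x := mv A (w x).
Let v x i := mv A (s x) i - kappa * sg * mv G (s x) i + kappa * sg ^+ 2 * mv G (w x) i.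
(* w . v, less kappa / 2 times |Ax|^2 and kappa s^2 / 2 times |Aw|^2. *)
Let Phi x := dot (w x) (mv A (s x)) - kappa * sg * dot (s x) (mv G (w x))
  + kappa * sg ^+ 2 / 2 * dot (w x) (mv G (w x)) - kappa / 2 * dot (s x) (mv G (s x)).

Let k2 : 2 <= k. Proof. by have := M0; rewrite /k; lra. Qed.
Let e0_gt0 : 0 < e0. Proof. exact: expR_gt0. Qed.
Let e0_le1 : e0 <= 1. Proof. by rewrite /e0 -[leRHS]expR0 ler_expR; have := M0; lra. Qed.
Let sg_gt0 : 0 < sg. Proof. by apply: divr_gt0 => //; have := k2; lra. Qed.
Let e0E : e0 = 2 * k * sg. Proof. by rewrite /sg; field; have := k2; lra. Qed.
Let sg_le1 : sg <= 1. 
Proof.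
have := ler_wpM2r (ltW sg_gt0) k2; have := e0E; have := e0_le1; have := sg_gt0; lra.
Qed.
Let c1 : 0 <= kappa * sg <= 1.
Proof.
have /ltW h := kappa0; have /ltW h' := sg_gt0.
by apply/andP; split; [exact: mulr_ge0|exact: mulr_ile1].
Qed.
Let c2 : 0 <= kappa * sg ^+ 2 <= 1.
Proof.
have /ltW h := kappa0; have /ltW h' := sg_gt0.
have q : 0 <= sg ^+ 2 by exact: exprn_ge0.
by apply/andP; split; [exact: mulr_ge0|apply: mulr_ile1 => //; exact: exprn_ile1].
Qed.
Let sqr_le1 (c : R) : 0 <= c <= 1 -> c ^+ 2 <= 1.
Proof. by move=> /andP[? ?]; rewrite exprn_ile1. Qed.
Let Gs : symm G. Proof. exact: symm_mulmx. Qed.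
Let Ak : rows_le k A.
Proof. by move=> i; apply: le_trans (AM i) _; rewrite /k; have := M0; lra. Qed.
Let tau_ge0 : 0 <= tau. Proof. exact: frob2_ge0. Qed.

Let sqn_mvG z : sqn (mv G z) <= k ^+ 2 * sqn (mv A z).
Proof.
apply: le_trans (sqn_mv_le (mv A z) As Ak).
by apply: ler_sum => i _; rewrite mv_mulmx.
Qed.

Let frob2G : frob2 G <= k ^+ 2 * tau. Proof. exact: frob2_mulmx_le. Qed.

Lemma dot_resid_v x :
  dot (w x) (v x) = Phi x + kappa / 2 * sqn (a x) + kappa * sg ^+ 2 / 2 * sqn (b x).
Proof.
have -> : dot (w x) (v x) = dot (w x) (mv A (s x)) - kappa * sg * dot (w x) (mv G (s x))
    + kappa * sg ^+ 2 * dot (w x) (mv G (w x)).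
  rewrite /dot !mulr_sumr -sumrB -big_split /=; apply: eq_bigr => i _.
  by rewrite /v; ring.
rewrite /Phi (dot_mvC (s x) (w x) Gs) !(dot_mv_mulmx _ _ As) !dot_sqn -/(a x) -/(b x).
by field.
Qed.

(** The i-th entry of AAx changes by exactly 2 x_i |A_i|^2, and w_i x_i is at
    least exp(-2M): this gives the negative sign.  The positive contribution of
    AAw is of order s^2 and costs half of it. *)
Lemma drift_le x :
  \sum_i w x i * (v x i - v (flip i x) i) / 2 <= - (kappa * sg * e0 / 2 * tau).
Proof.
pose d i := mv G (w x) i - mv G (w (flip i x)) i.
have /andP[ks0 _] := c1; have /andP[ks2 _] := c2.
have h1 i : w x i * (v x i - v (flip i x) i) / 2 <=
   - (kappa * sg * e0) * (\sum_j A i j ^+ 2) +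
   kappa * sg ^+ 2 * (\sum_j `|G i j| * `|influence i j|).
  have -> : v x i - v (flip i x) i = - (kappa * sg) * ((\sum_j A i j ^+ 2) * (2 * s x i))
     + kappa * sg ^+ 2 * d i.
    rewrite -(mulmx_diag i As) -(mv_flip_diff G) /d.
    have := mv_flip_diff A i x i; rewrite Ad mul0r => /subr0_eq H.
    by rewrite /v /s H; ring.
  have q0 : 0 <= \sum_j A i j ^+ 2 by apply: sumr_ge0 => j _; apply: sqr_ge0.
  have -> : w x i * (- (kappa * sg) * ((\sum_j A i j ^+ 2) * (2 * s x i))
     + kappa * sg ^+ 2 * d i) / 2 =
     - (kappa * sg) * (\sum_j A i j ^+ 2) * (w x i * s x i) +
     kappa * sg ^+ 2 * (w x i * d i / 2) by field.
  apply: lerD.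
    have := spin_resid_ge x i; rewrite -/e0 => h.
    have : 0 <= kappa * sg * (\sum_j A i j ^+ 2) by rewrite mulr_ge0.
    by move=> h'; have := ler_wpM2l h' h; lra.
  apply: ler_wpM2l => //; apply: le_trans (ler_norm _) _.
  rewrite !normrM normfV (ger0_norm (ler0n R 2)) ler_pdivrMr // mulrC.
  by apply: ler_pM => //; [apply: diag_variation controlled_resid|apply: norm_resid_le2].
apply: le_trans (ler_sum _ (fun i _ => h1 i)) _.
rewrite big_split /= -!mulr_sumr -/(frob2 A) -/tau.
have := gram_weight_le As influence_symm influence_rows; rewrite -/G -/tau => g.
have := ler_wpM2l ks2 g.
have -> : kappa * sg ^+ 2 * (k * tau) = kappa * sg * e0 / 2 * tau by rewrite e0E; field.
lra.
Qed.

Lemma sqn_v_le x : sqn (v x) <= 6 * k ^+ 2 * (sqn (a x) + sqn (b x)).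
Proof.
have h1 i : v x i ^+ 2 <= 3 * (mv A (s x) i ^+ 2 + mv G (s x) i ^+ 2 + mv G (w x) i ^+ 2).
  apply: le_trans (sqr_add3 _ _ _) _; apply: ler_wpM2l => //.
  have ks := sqr_le1 c1.
  have ks2 := sqr_le1 c2.
  rewrite sqrrN [X in _ + X + _]exprMn [X in _ + _ + X]exprMn.
  have := ler_wpM2r (sqr_ge0 (mv G (s x) i)) ks.
  have := ler_wpM2r (sqr_ge0 (mv G (w x) i)) ks2; rewrite !mul1r; lra.
apply: le_trans (ler_sum _ (fun i _ => h1 i)) _.
rewrite -mulr_sumr !big_split /= -/(sqn (mv A (s x))) -/(sqn (mv G (s x)))
  -/(sqn (mv G (w x))) -/(a x).
have := sqn_mvG (s x); have := sqn_mvG (w x); rewrite -/(a x) -/(b x).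
have qa := sqn_ge0 (a x); have qb := sqn_ge0 (b x).
have k1 : 1 <= k ^+ 2 by rewrite expr_ge1 //; have := k2; lra.
have := ler_wpM2r qa k1; have := ler_wpM2r qb k1; lra.
Qed.

Lemma v_variation x : \sum_i (v x i - v (flip i x) i) ^+ 2 <= 9 * k ^+ 4 * tau.
Proof.
pose dA i := mv A (s x) i - mv A (s (flip i x)) i.
pose dG i := mv G (s x) i - mv G (s (flip i x)) i.
pose dW i := mv G (w x) i - mv G (w (flip i x)) i.
have h1 i : (v x i - v (flip i x) i) ^+ 2 <= 3 * (dA i ^+ 2 + dG i ^+ 2 + dW i ^+ 2).
  have -> : v x i - v (flip i x) i = dA i + (- (kappa * sg * dG i)) + kappa * sg ^+ 2 * dW i.
    by rewrite /v /dA /dG /dW; ring.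
  apply: le_trans (sqr_add3 _ _ _) _; apply: ler_wpM2l => //.
  have ks := sqr_le1 c1.
  have ks2 := sqr_le1 c2.
  rewrite sqrrN [X in _ + X + _]exprMn [X in _ + _ + X]exprMn.
  have g1 := sqr_ge0 (dG i); have g2 := sqr_ge0 (dW i).
  have := ler_wpM2r g1 ks; have := ler_wpM2r g2 ks2; rewrite !mul1r; lra.
apply: le_trans (ler_sum _ (fun i _ => h1 i)) _.
rewrite -mulr_sumr !big_split /=.
have hA := diag_variation_sqr A x controlled_sx.
have hG := diag_variation_sqr G x controlled_sx.
have hW := diag_variation_sqr G x controlled_resid.
have k1 : 1 <= k ^+ 2 by rewrite expr_ge1 //; have := k2; lra.
have kk0 : 0 <= k ^+ 2 by exact: sqr_ge0.
have fG := ler_wpM2l kk0 frob2G.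
have fA := ler_wpM2r (mulr_ge0 kk0 tau_ge0) k1.
rewrite -/tau in hA; rewrite /dA /dG /dW.
have -> : 9 * k ^+ 4 * tau = 9 * (k ^+ 2 * (k ^+ 2 * tau)) by ring.
lra.
Qed.

Lemma Phi_variation x : \sum_i (Phi x - Phi (flip i x)) ^+ 2 <=
  84 * k ^+ 4 * (sqn (a x) + sqn (b x)) + 48 * k ^+ 6 * tau.
Proof.
pose f1 x := dot (w x) (mv A (s x)).
pose f2 x := dot (s x) (mv G (w x)).
pose f3 x := dot (w x) (mv G (w x)).
pose f4 x := dot (s x) (mv G (s x)).
have h1 i : (Phi x - Phi (flip i x)) ^+ 2 <=
   4 * ((f1 x - f1 (flip i x)) ^+ 2 + (f2 x - f2 (flip i x)) ^+ 2 +
        (f3 x - f3 (flip i x)) ^+ 2 + (f4 x - f4 (flip i x)) ^+ 2).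
  have -> : Phi x - Phi (flip i x) = (f1 x - f1 (flip i x)) +
     (- (kappa * sg)) * (f2 x - f2 (flip i x)) +
     (kappa * sg ^+ 2 / 2) * (f3 x - f3 (flip i x)) +
     (- (kappa / 2)) * (f4 x - f4 (flip i x)).
    by rewrite /Phi /f1 /f2 /f3 /f4; ring.
  apply: le_trans (sqr_add4 _ _ _ _) _; apply: ler_wpM2l => //.
  have ks : (- (kappa * sg)) ^+ 2 <= 1.
    by rewrite sqrrN sqr_le1.
  have ks2 : (kappa * sg ^+ 2 / 2) ^+ 2 <= 1.
    have /andP[q q'] := c2; apply: sqr_le1; apply/andP; lra.
  have ks3 : (- (kappa / 2)) ^+ 2 <= 1 
    by rewrite sqrrN; apply: sqr_le1; have := kappa0; have := kappa1; move=> ? ?; apply/andP; lra.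
  rewrite [X in _ + X + _ + _]exprMn [X in _ + X + _]exprMn [X in _ + _ + X]exprMn.
  have := ler_wpM2r (sqr_ge0 (f2 x - f2 (flip i x))) ks.
  have := ler_wpM2r (sqr_ge0 (f3 x - f3 (flip i x))) ks2.
  have := ler_wpM2r (sqr_ge0 (f4 x - f4 (flip i x))) ks3.
  rewrite !mul1r; lra.
apply: le_trans (ler_sum _ (fun i _ => h1 i)) _.
rewrite -mulr_sumr !big_split /=.
have H1 := form_variation x As controlled_resid controlled_sx.
have H2 := form_variation x Gs controlled_sx controlled_resid.
have H3 := form_variation x Gs controlled_resid controlled_resid.
have H4 := form_variation x Gs controlled_sx controlled_sx.
have k1 : 1 <= k ^+ 2 by rewrite expr_ge1 //; have := k2; lra.
have kk0 : 0 <= k ^+ 2 by exact: sqr_ge0.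
have kk4 : 0 <= k ^+ 4 by rewrite exprn_ge0 //; have := k2; lra.
have Ga := ler_wpM2l kk0 (sqn_mvG (s x)); have Gb := ler_wpM2l kk0 (sqn_mvG (w x)).
rewrite -/(a x) in Ga H1; rewrite -/(b x) in Gb H1; rewrite -/tau in H1.
have Gf := ler_wpM2l kk4 frob2G.
have qa := ler_wpM2r (mulr_ge0 kk0 (sqn_ge0 (a x))) k1.
have qb := ler_wpM2r (mulr_ge0 kk0 (sqn_ge0 (b x))) k1.
have qt := ler_wpM2r (mulr_ge0 kk4 tau_ge0) k1.
have p0a := sqn_ge0 (a x); have p0b := sqn_ge0 (b x).
have Ea : k ^+ 2 * (k ^+ 2 * sqn (a x)) = k ^+ 4 * sqn (a x) by ring.
have Eb : k ^+ 2 * (k ^+ 2 * sqn (b x)) = k ^+ 4 * sqn (b x) by ring.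
have Et : k ^+ 2 * (k ^+ 4 * tau) = k ^+ 6 * tau by ring.
have Et' : k ^+ 4 * (k ^+ 2 * tau) = k ^+ 6 * tau by ring.
rewrite Ea in qa Ga; rewrite Eb in qb Gb; rewrite Et in qt; rewrite Et' in Gf.
have -> : 84 * k ^+ 4 * (sqn (a x) + sqn (b x)) + 48 * k ^+ 6 * tau =
  84 * (k ^+ 4 * sqn (a x)) + 84 * (k ^+ 4 * sqn (b x)) + 48 * (k ^+ 6 * tau) by ring.
have P1 : 0 <= k ^+ 4 * sqn (a x) by rewrite mulr_ge0.
have P2 : 0 <= k ^+ 4 * sqn (b x) by rewrite mulr_ge0.
move: H1 H2 H3 H4; rewrite /f1 /f2 /f3 /f4; lra.
Qed.

Let lam := mgf_lambda M kappa.
Let c := mgf_rate M kappa.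

Let lam_gt0 : 0 < lam.
Proof.
have k0 : 0 < k by apply: lt_le_trans k2.
apply: divr_gt0; apply: mulr_gt0 => //; apply: exprn_gt0 => //; exact: sg_gt0.
Qed.

(** The drift pays for the multiples of |A|_F^2, and the two subtracted squared
    norms pay for the multiples of |Ax|^2 and |Aw|^2. *)
Lemma tilted_pointwise x :
  \sum_i (w x i * (v x i - v (flip i x) i) / 2 +
    lam * (4 * v x i ^+ 2 + (v x i - v (flip i x) i) ^+ 2 +
           (Phi x - Phi (flip i x)) ^+ 2 / 2))
  - kappa / 2 * sqn (a x) - kappa * sg ^+ 2 / 2 * sqn (b x) + c * tau <= 0.
Proof.
rewrite big_split /= -mulr_sumr !big_split /= -mulr_sumr.
have -> : \sum_i (Phi x - Phi (flip i x)) ^+ 2 / 2 =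
  (\sum_i (Phi x - Phi (flip i x)) ^+ 2) / 2 by rewrite mulr_suml.
have D := drift_le x.
have V : \sum_i v x i ^+ 2 <= 6 * k ^+ 2 * (sqn (a x) + sqn (b x)) := sqn_v_le x.
have V' := v_variation x; have P := Phi_variation x.
have qa := sqn_ge0 (a x); have qb := sqn_ge0 (b x).
have k0 : 0 < k by apply: lt_le_trans k2.
have k1 : 1 <= k ^+ 2 by rewrite expr_ge1 //; have := k2; lra.
have kk4 : 0 <= k ^+ 4 by rewrite exprn_ge0 // ltW.
have kk2 : 0 <= k ^+ 2 by rewrite exprn_ge0 // ltW.
set Q := sqn (a x) + sqn (b x) in V P.
have Q0 : 0 <= Q by rewrite addr_ge0.
have E1 := ler_wpM2r (mulr_ge0 kk2 Q0) k1.
have E2 := ler_wpM2r (mulr_ge0 kk4 tau_ge0) k1.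
have E3 := ler_wpM2r (mulr_ge0 kk4 Q0) k1.
set S := 4 * _ + _ + _.
have HS : S <= 66 * (k ^+ 6 * Q) + 33 * (k ^+ 6 * tau).
  have e1 : k ^+ 2 * (k ^+ 2 * Q) = k ^+ 4 * Q by ring.
  have e2 : k ^+ 2 * (k ^+ 4 * tau) = k ^+ 6 * tau by ring.
  have e3 : k ^+ 2 * (k ^+ 4 * Q) = k ^+ 6 * Q by ring.
  rewrite e1 mul1r in E1; rewrite e2 mul1r in E2; rewrite e3 mul1r in E3.
  by rewrite /S; lra.
have HL := ler_wpM2l (ltW lam_gt0) HS.
have L6 : lam * k ^+ 6 = kappa * sg ^+ 2 / 132.
  have -> : lam = kappa * sg ^+ 2 / (132 * k ^+ 6) by [].
  by field; rewrite gt_eqF.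
have F1 : lam * (66 * (k ^+ 6 * Q) + 33 * (k ^+ 6 * tau)) =
  kappa * sg ^+ 2 / 2 * Q + kappa * sg ^+ 2 / 4 * tau.
  have -> : lam * (66 * (k ^+ 6 * Q) + 33 * (k ^+ 6 * tau)) =
    (lam * k ^+ 6) * (66 * Q + 33 * tau) by ring.
  by rewrite L6; field.
have cE : c * tau = kappa * sg * e0 / 4 * tau by [].
have /andP[ks0 _] := c1.
have sg2 : kappa * sg ^+ 2 <= kappa by rewrite ger_pMr ?exprn_ile1 // ltW.
have G1 : kappa * sg ^+ 2 * tau <= kappa * sg * e0 * tau.
  apply: ler_wpM2r => //; rewrite expr2 mulrA; apply: ler_wpM2l => //.
  have := ler_wpM2r (ltW sg_gt0) k2; rewrite e0E; have := sg_gt0; lra.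
have G2 := ler_wpM2r qa sg2.
rewrite cE; rewrite F1 in HL; rewrite /Q in HL; lra.
Qed.

Lemma tilted_expect_le0 :
  expect J (fun x => (Phi x + c * tau) * expR (lam * Phi x)) <= 0.
Proof.
pose g i x := (w x i * (v x i - v (flip i x) i) / 2 +
    lam * (4 * v x i ^+ 2 + (v x i - v (flip i x) i) ^+ 2 +
           (Phi x - Phi (flip i x)) ^+ 2 / 2)) * expR (lam * Phi x).
pose r x := (- (kappa / 2) * sqn (a x) - kappa * sg ^+ 2 / 2 * sqn (b x) + c * tau)
            * expR (lam * Phi x).
have -> : expect J (fun x => (Phi x + c * tau) * expR (lam * Phi x)) =
  \sum_i expect J (fun x => w x i * v x i * expR (lam * Phi x)) + expect J r.
  rewrite -expect_sum -expectD; apply: eq_expect => x.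
  rewrite /r /= -mulr_suml -mulrDl; congr (_ * _).
  by have := dot_resid_v x; rewrite {1}/dot => ->; ring.
apply: (@le_trans _ _ (\sum_i expect J (g i) + expect J r)).
  rewrite lerD2r; apply: ler_sum => i _.
  exact: (expect_resid_expR Js Jd i (fun x => v x i) Phi (ltW lam_gt0)).
rewrite -expect_sum -expectD -[leRHS](expect_cst J 0); apply: ler_expect => x.
rewrite /g /r /= -mulr_suml -mulrDl; apply: mulr_le0_ge0; last exact: expR_ge0.
have := tilted_pointwise x; lra.
Qed.

(** By convexity, e^y <= 1 + y e^y; with y = lam (Phi + c |A|_F^2) the expectation
    of y e^y is nonpositive by [tilted_expect_le0].  Only one value of lam is
    needed, so no differential inequality has to be integrated. *)
Lemma contrast_mgf :
  expect J (fun x => expR (lam * (dot (w x) (mv A (s x)) - kappa * sqn (mv A (s x)))))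
  <= expR (- (lam * c * tau)).
Proof.
have h1 : expect J (fun x => expR (lam * (Phi x + c * tau))) <= 1.
  have e1 y : expR y <= 1 + y * expR y.
    have := expR_ge1Dx (- y); rewrite expRN -(ler_pM2r (expR_gt0 y)).
    by rewrite mulVf ?gt_eqF ?expR_gt0 //; lra.
  have e2 : expect J (fun x => expR (lam * (Phi x + c * tau))) <=
    expect J (fun x => 1 + lam * (Phi x + c * tau) * expR (lam * (Phi x + c * tau))).
    by apply: ler_expect => x; apply: e1.
  apply: (le_trans e2).
  rewrite expectD expect_cst -[leRHS]addr0 lerD2l.
  have -> : expect J (fun x => lam * (Phi x + c * tau) * expR (lam * (Phi x + c * tau)))
    = lam * expR (lam * (c * tau)) *
      expect J (fun x => (Phi x + c * tau) * expR (lam * Phi x)).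
    rewrite -expectZ; apply: eq_expect => x.
    by rewrite [lam * (_ + _)]mulrDr expRD; ring.
  apply: mulr_ge0_le0; last exact: tilted_expect_le0.
  by rewrite mulr_ge0 ?expR_ge0 // ltW.
have h2 : expect J (fun x => expR (lam * (Phi x + c * tau))) =
   expR (lam * (c * tau)) * expect J (fun x => expR (lam * Phi x)).
  by rewrite -expectZ; apply: eq_expect => x; rewrite mulrDr expRD mulrC.
(* Phi minus the contrast is kappa / 2 times |Ax - s Aw|^2. *)
apply: (@le_trans _ _ (expect J (fun x => expR (lam * Phi x)))).
  apply: ler_expect => x; rewrite ler_expR; apply: ler_wpM2l; first exact: ltW.
  have H : 0 <= sqn (fun i => a x i - sg * b x i) by exact: sqn_ge0.
  have HE : sqn (fun i => a x i - sg * b x i) =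
     sqn (a x) - 2 * sg * dot (a x) (b x) + sg ^+ 2 * sqn (b x).
    rewrite /sqn /dot !mulr_sumr -sumrB -big_split /=; apply: eq_bigr => i _; ring.
  rewrite HE in H; have := ler_wpM2l (ltW kappa0) H; rewrite mulr0.
  rewrite /Phi !(dot_mv_mulmx _ _ As) !dot_sqn -/(a x) -/(b x); lra.
rewrite -mulrA expRN -[leRHS]mul1r ler_pdivlMr ?expR_gt0 // mulrC -h2; exact: h1.
Qed.

End ContrastMgf.

(** * Uniform deviation over independent samples *)

Section Iid.
Variables (R : realType) (n l : nat) (J : 'M[R]_n).
Implicit Types (X : samples l n) (E : pred (samples l n)).

Definition iid_weight X : R := \prod_(t < l) ising J (X t).

Lemma iid_weight_ge0 X : 0 <= iid_weight X.
Proof. by apply: prodr_ge0 => t _; apply: ising_ge0. Qed.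

Lemma iid_expect_prod (f : config n -> R) :
  \sum_X iid_weight X * \prod_t f (X t) = expect J f ^+ l.
Proof.
rewrite -[RHS](_ : \prod_(t < l) expect J f = _); last by rewrite prodr_const card_ord.
rewrite /expect bigA_distr_bigA /=; apply: eq_bigr => X _.
by rewrite /iid_weight -big_split.
Qed.

Lemma iid_weight_sum1 : \sum_X iid_weight X = 1.
Proof.
have := iid_expect_prod (fun=> 1); rewrite expect_cst expr1n => <-.
by apply: eq_bigr => X _; rewrite big1_eq mulr1.
Qed.

Lemma iid_ising_prob_mono E E' : (forall X, E X -> E' X) ->
  iid_ising_prob J E <= iid_ising_prob J E'.
Proof.
move=> EE'; rewrite /iid_ising_prob [leRHS]big_mkcond [leLHS]big_mkcond /=.
apply: ler_sum => X _; case: ifP => [/EE' -> //|_].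
by case: ifP => // _; apply: iid_weight_ge0.
Qed.

Lemma iid_union_bound (I : finType) (good : pred I) (F : I -> samples l n -> R) u :
  (forall g, good g -> \sum_X iid_weight X * expR (F g X) <= 1) ->
  1 - #|I|%:R * expR (- u) <=
  iid_ising_prob J (fun X => [forall g, good g ==> (F g X <= u)]).
Proof.
move=> mgf; set E := fun X => _.
have tot : iid_ising_prob J E + \sum_(X | ~~ E X) iid_weight X = 1.
  by rewrite -[RHS]iid_weight_sum1 [RHS](bigID E).
suff : \sum_(X | ~~ E X) iid_weight X <= #|I|%:R * expR (- u) by move: tot; lra.
apply: (@le_trans _ _ (\sum_X \sum_(g | good g) iid_weight X * expR (F g X - u))).
  rewrite big_mkcond /=; apply: ler_sum => X _.
  have s0 : 0 <= \sum_(g | good g) iid_weight X * expR (F g X - u).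
    by apply: sumr_ge0 => g _; rewrite mulr_ge0 ?iid_weight_ge0 ?expR_ge0.
  case: ifP => // /forallPn[g]; rewrite negb_imply -ltNge => /andP[gg lt].
  rewrite (bigD1 g) //=; apply: (@le_trans _ _ (iid_weight X * expR (F g X - u))).
    rewrite -[leLHS]mulr1; apply: ler_wpM2l; first exact: iid_weight_ge0.
    by rewrite -[leLHS]expR0 ler_expR; lra.
  by rewrite lerDl; apply: sumr_ge0 => h _; rewrite mulr_ge0 ?iid_weight_ge0 ?expR_ge0.
rewrite exchange_big /=; apply: (@le_trans _ _ (\sum_(g | good g) expR (- u))).
  apply: ler_sum => g gg.
  rewrite (eq_bigr (fun X => iid_weight X * expR (F g X) * expR (- u))); last first.
    by move=> X _; rewrite expRD mulrA.
  by rewrite -mulr_suml -[leRHS]mul1r; apply: ler_wpM2r; [exact: expR_ge0|exact: mgf].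
apply: (@le_trans _ _ (\sum_(g : I) expR (- u))).
  rewrite [leLHS]big_mkcond; apply: ler_sum => g _; case: ifP => // _; exact: expR_ge0.
by rewrite sumr_const mulr_natl.
Qed.

End Iid.

Section Rounding.
Variables (R : realType) (n N : nat).
Hypothesis N0 : (0 < N)%N.
Implicit Types (A : 'M[R]_n) (a : R).

(** Rounding towards zero keeps symmetry, the zero diagonal and the bound on the
    row sums. *)
Definition round_entry a : R :=
  (if 0 <= a then 1 else -1) * (Num.trunc (N%:R * `|a|))%:R / N%:R.

Definition round_mx A : 'M[R]_n := \matrix_(i, j) round_entry (A i j).

Lemma N_gt0 : 0 < N%:R :> R. Proof. by rewrite ltr0n. Qed.

Lemma round_entry_error a : `|a - round_entry a| <= N%:R^-1.
Proof.
have N1 := N_gt0.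
have /andP[] := truncn_itv (mulr_ge0 (ler0n R N) (normr_ge0 a)).
rewrite /round_entry -natr1; set m := (Num.trunc _)%:R => h1 h2.
rewrite -(ler_pM2r N1) -[X in _ * X <= _](ger0_norm (ltW N1)) -normrM mulVf ?gt_eqF //.
rewrite mulrBl mulfVK ?gt_eqF //; move: h1 h2.
case: (lerP 0 a) => a0; rewrite ?(ger0_norm a0) ?(ltr0_norm a0) ler_norml => ? ?;
  apply/andP; lra.
Qed.

Lemma norm_round_entry_le a : `|round_entry a| <= `|a|.
Proof.
have N1 := N_gt0; rewrite /round_entry !normrM.
have -> : `|if 0 <= a then 1 else -1 : R| = 1 by case: ifP; rewrite ?normrN normr1.
rewrite mul1r normr_nat normfV normr_nat ler_pdivrMr // mulrC truncn_le.
by rewrite mulr_ge0.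
Qed.

Lemma round_entry0 : round_entry 0 = 0.
Proof. by rewrite /round_entry normr0 mulr0 truncn0 mulr0 mul0r. Qed.

(** The entries of g are shifted by L, to encode the integers from - L to L. *)
Definition grid_mx L (g : {ffun 'I_n * 'I_n -> 'I_(L + L).+1}) : 'M[R]_n :=
  \matrix_(i, j) (((g (i, j) : nat)%:R - L%:R) / N%:R).

Lemma round_mx_in_grid L A : (forall i j, N%:R * `|A i j| <= L%:R) ->
  exists g, round_mx A = grid_mx (L := L) g.
Proof.
move=> AL; pose m i j := Num.trunc (N%:R * `|A i j|).
have mL i j : (m i j <= L)%N.
  by rewrite /m truncn_le_nat; apply: le_lt_trans (AL i j) _; rewrite ltr_nat.
exists [ffun p => inord (if 0 <= A p.1 p.2 then (L + m p.1 p.2)%N else (L - m p.1 p.2)%N)].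
apply/matrixP => i j; rewrite !mxE ffunE /= /round_entry -/(m i j).
rewrite inordK; last by case: ifP => _; rewrite ltnS ?leq_add2l // (leq_trans (leq_subr _ _)) ?leq_addl.
case: ifP => _; first by rewrite natrD; congr (_ / _); ring.
by rewrite natrB //; congr (_ / _); ring.
Qed.

Lemma round_mx_symm A : symm A -> symm (round_mx A).
Proof. by move=> As i j; rewrite !mxE As. Qed.

Lemma round_mx_diag A : (forall i, A i i = 0) -> forall i, round_mx A i i = 0.
Proof. by move=> Ad i; rewrite mxE Ad round_entry0. Qed.

Lemma round_mx_rows k A : rows_le k A -> rows_le k (round_mx A).
Proof.
move=> Ak i; apply: le_trans (Ak i); apply: ler_sum => j _.
by rewrite mxE norm_round_entry_le.
Qed.

End Rounding.

Section Contrast.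
Variables (R : realType) (n : nat) (J : 'M[R]_n) (kappa : R).
Hypotheses (kappa0 : 0 <= kappa) (kappa1 : kappa <= 1).
Implicit Types (A B : 'M[R]_n) (x : config n).

(** Minus a lower bound for the derivative along A of the negative log
    pseudo-likelihood at J + A, when kappa bounds the slope of tanh from below. *)
Definition contrast A x : R :=
  dot (resid J x) (mv A (sx R x)) - kappa * sqn (mv A (sx R x)).

Lemma contrast_perturb k e A B x : rows_le k A -> rows_le k B ->
  (forall i j, `|A i j - B i j| <= e) ->
  contrast A x <= contrast B x + n%:R ^+ 2 * e * (2 + 2 * k).
Proof.
move=> Ak Bk AB.
have D i : `|mv A (sx R x) i - mv B (sx R x) i| <= n%:R * e.
  rewrite /mv -sumrB; apply: le_trans (ler_norm_sum _ _ _) _.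
  rewrite -[n in leRHS]card_ord mulr_natl -sumr_const; apply: ler_sum => j _.
  by rewrite -mulrBl normrM norm_sx mulr1.
pose a i := mv A (sx R x) i; pose b i := mv B (sx R x) i.
have T i : resid J x i * a i - kappa * a i ^+ 2 <=
    resid J x i * b i - kappa * b i ^+ 2 + n%:R * e * (2 + 2 * k).
  rewrite -lerBlDl.
  have -> : resid J x i * a i - kappa * a i ^+ 2 - (resid J x i * b i - kappa * b i ^+ 2)
     = (a i - b i) * (resid J x i - kappa * (a i + b i)) by ring.
  apply: le_trans (ler_norm _) _; rewrite normrM; apply: ler_pM => //.
  apply: le_trans (ler_normB _ _) _; apply: lerD; first exact: norm_resid_le2.
  rewrite normrM (ger0_norm kappa0) -[leRHS]mul1r; apply: ler_pM => //.
  apply: le_trans (ler_normD _ _) _.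
  by have := norm_mv_sx_le x i Ak; have := norm_mv_sx_le x i Bk; rewrite -/(a i) -/(b i); lra.
have -> : contrast A x = \sum_i (resid J x i * a i - kappa * a i ^+ 2).
  by rewrite /contrast /dot /sqn mulr_sumr -sumrB.
have -> : contrast B x = \sum_i (resid J x i * b i - kappa * b i ^+ 2).
  by rewrite /contrast /dot /sqn mulr_sumr -sumrB.
apply: le_trans (ler_sum _ (fun i _ => T i)) _.
rewrite big_split /= sumr_const card_ord lerD2l -mulr_natl; lra.
Qed.

Lemma frob2_perturb e A B : (forall i j, `|A i j - B i j| <= e) ->
  frob2 A <= 2 * frob2 B + 2 * n%:R ^+ 2 * e ^+ 2.
Proof.
move=> AB; have T i j : A i j ^+ 2 <= 2 * B i j ^+ 2 + 2 * e ^+ 2.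
  have := ler_sqr_norm (AB i j); have := sqr_ge0 (A i j - 2 * B i j); lra.
apply: le_trans (ler_sum _ (fun i _ => ler_sum _ (fun j _ => T i j))) _.
under eq_bigr do rewrite big_split /= sumr_const card_ord -mulr_sumr.
rewrite big_split /= sumr_const card_ord -mulr_sumr lerD2l -mulrnA -[leLHS]mulr_natl natrM; lra.
Qed.

End Contrast.

Section UniformDeviation.
Variables (R : realType) (n l : nat) (J : 'M[R]_n) (M kappa delta : R).
Hypotheses (Js : symm J) (Jd : forall i, J i i = 0) (JM : rows_le M J).
Hypotheses (M0 : 0 < M) (kappa0 : 0 < kappa) (kappa1 : kappa <= 1).
Hypotheses (delta0 : 0 < delta) (n0 : (0 < n)%N) (l0 : (0 < l)%N).

Let lam := mgf_lambda M kappa.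
Let c := mgf_rate M kappa.

Lemma mgf_lambda_gt0 : 0 < lam.
Proof.
have k0 : 0 < 2 + 8 * M by have := M0; lra.
apply: divr_gt0; apply: mulr_gt0 => //; apply: exprn_gt0 => //.
by apply: divr_gt0; rewrite ?expR_gt0 // mulr_gt0.
Qed.

Lemma mgf_rate_gt0 : 0 < c.
Proof.
have k0 : 0 < 2 + 8 * M by have := M0; lra.
apply: divr_gt0 => //; apply: mulr_gt0; last exact: expR_gt0.
by apply: mulr_gt0 => //; apply: divr_gt0; rewrite ?expR_gt0 // mulr_gt0.
Qed.

(** The grid of mesh 1 / (n l) has at most ((4M + 5) n l)^(n^2) points, which is
    where n^2 log (n l) comes from; rounding A to it changes the total contrast
    by at most n (2 + 4M). *)
Lemma uniform_deviation : exists E : pred (samples l n),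
  1 - delta <= iid_ising_prob J E /\
  forall X, E X -> forall A : 'M[R]_n,
    symm A -> (forall i, A i i = 0) -> rows_le (2 * M) A ->
    l%:R * lam * c * frob2 A <=
    2 * (n%:R ^+ 2 * ln (n%:R * l%:R * (4 * M + 5)) + ln (1 / delta)
         + lam * n%:R * (2 + 4 * M) - lam * \sum_t contrast J kappa A (X t))
    + 2 * lam * c.
Proof.
have lam0 := mgf_lambda_gt0; have c0 := mgf_rate_gt0.
pose N := (n * l)%N; have N0 : (0 < N)%N by rewrite muln_gt0 n0.
pose L := (Num.trunc (2 * M * N%:R)).+1.
have nR : 0 < n%:R :> R by rewrite ltr0n.
have lR : 0 < l%:R :> R by rewrite ltr0n.
have lR1 : 1 <= l%:R :> R by rewrite ler1n.
have NR : N%:R = n%:R * l%:R :> R by rewrite natrM.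
have NR0 : 0 < N%:R :> R by rewrite ltr0n.
pose good (g : {ffun 'I_n * 'I_n -> 'I_(L + L).+1}) : bool :=
  let B := grid_mx R N g in
  [&& [forall i, forall j, B i j == B j i], [forall i, B i i == 0] &
      [forall i, \sum_j `|B i j| <= 2 * M]].
have goodP g : good g -> [/\ symm (grid_mx R N g), (forall i, grid_mx R N g i i = 0)
    & rows_le (2 * M) (grid_mx R N g)].
  move=> /and3P[/forallP h1 /forallP h2 /forallP h3]; split.
  - by move=> i j; have /forallP/(_ j)/eqP := h1 i.
  - by move=> i; apply/eqP.
  - exact: h3.
pose F (g : {ffun 'I_n * 'I_n -> 'I_(L + L).+1}) (X : samples l n) := lam * \sum_t contrast J kappa (grid_mx R N g) (X t)
   + l%:R * (lam * c * frob2 (grid_mx R N g)).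
pose u := ln (#|{ffun 'I_n * 'I_n -> 'I_(L + L).+1}|%:R / delta).
have card0 : 0 < #|{ffun 'I_n * 'I_n -> 'I_(L + L).+1}|%:R :> R.
  by rewrite ltr0n card_ffun card_ord expn_gt0.
exists (fun X => [forall g, good g ==> (F g X <= u)]); split.
  apply: le_trans (iid_union_bound (J := J) (good := good) (F := F) u _).
    rewrite /u expRN lnK ?posrE ?divr_gt0 // invf_div mulrCA divff ?gt_eqF // mulr1.
    exact: lexx.
  move=> g /goodP[gs gd gr].
  rewrite (eq_bigr (fun X => iid_weight J X * (\prod_t expR (lam * contrast J kappa (grid_mx R N g) (X t))) * expR (l%:R * (lam * c * frob2 (grid_mx R N g))))); last first.
    by move=> X _; rewrite /F expRD mulr_sumr expR_sum mulrA.
  rewrite -mulr_suml (iid_expect_prod _ _ (fun x => expR (lam * contrast J kappa (grid_mx R N g) x))).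
  have mg := contrast_mgf Js Jd JM gs gd gr (ltW M0) kappa0 kappa1.
  rewrite expRM_natl -exprMn; apply: exprn_ile1.
    rewrite mulr_ge0 ?expR_ge0 //; apply: sumr_ge0 => x _.
    by rewrite mulr_ge0 ?ising_ge0 ?expR_ge0.
  have := ler_wpM2r (expR_ge0 (lam * c * frob2 (grid_mx R N g))) mg.
  by rewrite -expRD addNr expR0.
move=> X /forallP EX A As Ad Ar.
have AL i j : N%:R * `|A i j| <= L%:R.
  apply: le_trans (ltW (truncnS_gt (2 * M * N%:R))).
  by rewrite mulrC ler_pM2r // (entry_le_rows Ar).
have [g gE] := round_mx_in_grid AL.
have gg : good g.
  rewrite /good -gE; apply/and3P; split.
  - by apply/forallP => i; apply/forallP => j; apply/eqP/round_mx_symm.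
  - by apply/forallP => i; apply/eqP/round_mx_diag.
  - by apply/forallP => i; apply: round_mx_rows.
have := EX g; rewrite gg /= /F -gE => {EX} EX.
have err i j : `|A i j - round_mx N A i j| <= N%:R^-1 by rewrite mxE round_entry_error.
have fr := frob2_perturb err.
have ct t : contrast J kappa A (X t) <= contrast J kappa (round_mx N A) (X t) +
   n%:R ^+ 2 * N%:R^-1 * (2 + 2 * (2 * M)).
  exact: (contrast_perturb J (ltW kappa0) kappa1 (X t) Ar (round_mx_rows N0 Ar) err).
have {ct} : \sum_t contrast J kappa A (X t) <= \sum_t (contrast J kappa (round_mx N A) (X t) +
   n%:R ^+ 2 * N%:R^-1 * (2 + 2 * (2 * M))) by apply: ler_sum => t _.
have spl (f : 'I_l -> R) C : \sum_t (f t + C) = \sum_t f t + l%:R * C.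
  by rewrite big_split /= sumr_const card_ord mulr_natl.
rewrite spl.
have -> : l%:R * (n%:R ^+ 2 * N%:R^-1 * (2 + 2 * (2 * M))) = n%:R * (2 + 4 * M).
  by rewrite NR; field; rewrite !gt_eqF.
move=> ct.
have uE : u <= n%:R ^+ 2 * ln (n%:R * l%:R * (4 * M + 5)) + ln (1 / delta).
  rewrite /u div1r [leLHS]lnM ?posrE ?invr_gt0 // lerD2r card_ffun card_prod !card_ord.
  rewrite natrX lnXn ?ltr0n // -[leLHS]mulr_natl natrM -expr2; apply: ler_wpM2l; first exact: sqr_ge0.
  rewrite ler_ln ?posrE ?ltr0n //; last by rewrite !mulr_gt0 //; have := M0; lra.
  rewrite -natr1 natrD /L -natr1 -NR.
  have := truncn_itv (mulr_ge0 (mulr_ge0 (ler0n R 2) (ltW M0)) (ler0n R N)).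
  have : 1 <= N%:R :> R by rewrite ler1n.
  by move=> N1 /andP[h1 _]; lra.
have e2 : l%:R * (2 * n%:R ^+ 2 * (N%:R^-1) ^+ 2) <= 2 :> R.
  apply: (@le_trans _ _ (2 / l%:R)); last by rewrite ler_pdivrMr //; lra.
  rewrite le_eqVlt; apply/orP; left; apply/eqP; rewrite NR.
  by field; rewrite !gt_eqF.
have lc : 0 <= lam * c by rewrite mulr_ge0 // ltW.
have := ler_wpM2l lc (ler_wpM2l (ltW lR) fr).
have := ler_wpM2l lc e2; have := ler_wpM2l (ltW lam0) ct; lra.
Qed.

End UniformDeviation.

(** * Penalised descent *)

Section Clipping.
Variables (R : realType) (n : nat) (M : R).
Hypothesis M0 : 0 < M.
Implicit Types (J B : 'M[R]_n).

Definition row_norm J i : R := \sum_j `|J i j|.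
Definition shrink J i : R := if row_norm J i <= M then 1 else M / row_norm J i.
(** The symmetric product of both factors makes this an explicit map into
    the symmetric matrices with row sums at most M; the Euclidean projection has no closed form. *)
Definition clip J : 'M[R]_n := \matrix_(i, j) (J i j * shrink J i * shrink J j).
Definition violated J i : R := if row_norm J i <= M then 0 else 1.
Definition excess J i : R := violated J i * (row_norm J i - M).
(** J_ij / |J_ij| is the sign of J_ij, also at 0 since 0 / 0 = 0. *)
Definition penalty J : 'M[R]_n :=
  \matrix_(i, j) (J i j / `|J i j| * (violated J i + violated J j)).

Lemma row_norm_ge0 J i : 0 <= row_norm J i.
Proof. by apply: sumr_ge0. Qed.

Lemma shrink_bound J i : 0 <= shrink J i <= 1.
Proof.
rewrite /shrink; case: (lerP (row_norm J i) M) => h; first by rewrite lexx andbT.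
have r0 : 0 < row_norm J i by apply: lt_trans h.
apply/andP; split; first by rewrite divr_ge0 ?row_norm_ge0 // ltW.
by rewrite ler_pdivrMr // mul1r ltW.
Qed.

Lemma shrink_row_norm_le J i : shrink J i * row_norm J i <= M.
Proof.
rewrite /shrink; case: (lerP (row_norm J i) M) => h; first by rewrite mul1r.
by rewrite divfK // gt_eqF // (lt_trans M0 h).
Qed.

Lemma excessE J i : excess J i = row_norm J i * (1 - shrink J i).
Proof.
rewrite /excess /violated /shrink; case: (lerP (row_norm J i) M) => h; first by rewrite subrr mul0r mulr0.
by field; rewrite gt_eqF // (lt_trans M0 h).
Qed.

Lemma clip_symm J : symm J -> symm (clip J).
Proof. by move=> Js i j; rewrite !mxE Js mulrAC. Qed.

Lemma clip_diag J : (forall i, J i i = 0) -> forall i, clip J i i = 0.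
Proof. by move=> Jd i; rewrite mxE Jd !mul0r. Qed.

Lemma clip_rows J : rows_le M (clip J).
Proof.
move=> i; apply: le_trans (shrink_row_norm_le J i).
rewrite /row_norm mulr_sumr; apply: ler_sum => j _; rewrite mxE !normrM.
have /andP[s0 s1] := shrink_bound J i; have /andP[t0 t1] := shrink_bound J j.
rewrite !(ger0_norm s0) (ger0_norm t0) [X in X * _]mulrC -[leRHS]mulr1.
by apply: ler_wpM2l => //; rewrite mulr_ge0.
Qed.

(** Because 1 - s_i s_j <= (1 - s_i) + (1 - s_j), and r_i (1 - s_i) is the excess
    of row i. *)
Lemma clip_l1_le J : symm J ->
  \sum_i \sum_j `|J i j - clip J i j| <= 2 * \sum_i excess J i.
Proof.
move=> Js.
have T i j : `|J i j - clip J i j| <=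
    `|J i j| * (1 - shrink J i) + `|J i j| * (1 - shrink J j).
  have /andP[s0 s1] := shrink_bound J i; have /andP[t0 t1] := shrink_bound J j.
  rewrite mxE -mulrDr.
  have -> : J i j - J i j * shrink J i * shrink J j =
     J i j * (1 - shrink J i * shrink J j) by ring.
  have st : shrink J i * shrink J j <= 1 by rewrite mulr_ile1.
  rewrite normrM (ger0_norm (x := 1 - _)) ?subr_ge0 //; apply: ler_wpM2l => //.
  have : 0 <= (1 - shrink J i) * (1 - shrink J j) by rewrite mulr_ge0 ?subr_ge0.
  lra.
apply: le_trans (ler_sum _ (fun i _ => ler_sum _ (fun j _ => T i j))) _.
under eq_bigr do rewrite big_split.
rewrite big_split /= [X in _ + X <= _]exchange_big /= mulr_natl mulr2n.
apply: lerD; apply: ler_sum => i _; rewrite -mulr_suml excessE //.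
by apply: ler_wpM2r; [have /andP[? ?] := shrink_bound J i; rewrite subr_ge0|
   rewrite /row_norm; under eq_bigr do rewrite Js].
Qed.

Lemma sign_ge (z b : R) : `|z| - `|b| <= z / `|z| * (z - b).
Proof.
have [->|z0] := eqVneq z 0; first by rewrite normr0 mul0r mul0r sub0r oppr_le0.
have z1 : 0 < `|z| by rewrite normr_gt0.
have zz : z * z = `|z| * `|z| by rewrite -!expr2 real_normK ?num_real.
have -> : z / `|z| * (z - b) = z * z / `|z| - z * b / `|z|.
  by field; rewrite gt_eqF.
rewrite zz mulfK ?gt_eqF // lerD2l lerN2 ler_pdivrMr // -normrM [leRHS](_ : _ = `|z * b|).
  exact: ler_norm.
by rewrite !normrM mulrC.
Qed.

Lemma violated_bound J i : 0 <= violated J i <= 1.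
Proof. by rewrite /violated; case: ifP => _; apply/andP; split. Qed.

Lemma norm_penalty_le J i j : `|penalty J i j| <= 2.
Proof.
rewrite mxE normrM -[2]mul1r; apply: ler_pM => //.
  rewrite normrM normfV normr_id; have [->|z0] := eqVneq (J i j) 0.
    by rewrite normr0 mul0r ler01.
  by rewrite divff // normr_eq0.
have /andP[? ?] := violated_bound J i; have /andP[? ?] := violated_bound J j.
by rewrite ger0_norm; lra.
Qed.

Lemma penalty_symm J : symm J -> symm (penalty J).
Proof. by move=> Js i j; rewrite !mxE Js [violated J i + _]addrC. Qed.

Definition ip (U V : 'I_n -> 'I_n -> R) : R := \sum_i \sum_j U i j * V i j.

(** The penalty is a subgradient of twice the total row excess, which vanishes
    at B. *)
Lemma penalty_ge J B : symm J -> symm B -> rows_le M B ->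
  2 * \sum_i excess J i <= ip (penalty J) (fun i j => J i j - B i j).
Proof.
move=> Js Bs Br.
have h : \sum_i excess J i <=
    \sum_i \sum_j violated J i * (J i j / `|J i j| * (J i j - B i j)).
  apply: ler_sum => i _; rewrite -mulr_sumr; have /andP[v0 _] := violated_bound J i.
  apply: ler_wpM2l => //.
  apply: (@le_trans _ _ (\sum_j (`|J i j| - `|B i j|))); last first.
    by apply: ler_sum => j _; apply: sign_ge.
  by rewrite sumrB lerD2l lerN2.
have -> : ip (penalty J) (fun i j => J i j - B i j) =
    \sum_i \sum_j violated J i * (J i j / `|J i j| * (J i j - B i j)) +
    \sum_i \sum_j violated J i * (J i j / `|J i j| * (J i j - B i j)).
  rewrite [X in _ = _ + X]exchange_big /= -big_split; apply: eq_bigr => i _.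
  rewrite -big_split; apply: eq_bigr => j _ /=.
  by rewrite mxE [J j i]Js [B j i]Bs; ring.
by rewrite mulr_natl mulr2n lerD.
Qed.

End Clipping.

Lemma sumr_sub_cst (R : realType) m (f : 'I_m -> R) c :
  \sum_i (f i - c) = \sum_i f i - m%:R * c.
Proof. by rewrite sumrB sumr_const card_ord mulr_natl. Qed.

Section Descent.
Variables (R : realType) (n l : nat) (M : R) (X : samples l n).
Hypotheses (M0 : 0 < M) (n0 : (0 < n)%N) (l0 : (0 < l)%N).
Implicit Types (J B : 'M[R]_n).

(** The opposite of [resid] at B, with the approximate tanh. *)
Definition bias B (x : config n) i : R :=
  tanh_approx (n * l) (mv B (sx R x) i) - sx R x i.

Definition grad B : 'M[R]_n := \matrix_(i, j)
  if i == j then 0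
  else \sum_(t < l) (bias B (X t) i * sx R (X t) j + bias B (X t) j * sx R (X t) i).

(** The weight 4 l of the penalty is the bound on the entries of the gradient
    ([norm_grad_le]), so that the penalty outweighs the effect of clipping. *)
Definition direction J : 'M[R]_n := grad (clip M J) + (4 * l%:R) *: penalty M J.

Definition descent_step J : 'M[R]_n := J - ((n%:R * l%:R) ^+ 2)^-1 *: direction J.

Definition iterate k : 'M[R]_n := iter k descent_step 0.

Definition num_steps := (n ^ 3 * l ^ 2)%N.

Definition estimate : 'M[R]_n :=
  (num_steps%:R)^-1 *: \sum_(k < num_steps) clip M (iterate k).

Let nR : 0 < n%:R :> R. Proof. by rewrite ltr0n. Qed.
Let lR : 0 < l%:R :> R. Proof. by rewrite ltr0n. Qed.

Lemma grad_symm B : symm (grad B).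
Proof.
move=> i j; rewrite !mxE eq_sym; case: ifP => // _.
by apply: eq_bigr => t _; rewrite addrC.
Qed.

Lemma directionE J i j :
  direction J i j = grad (clip M J) i j + 4 * l%:R * penalty M J i j.
Proof.
have e (a : R) (B : 'M[R]_n) : (a *: B) i j = a * B i j by rewrite mxE.
have f (A B : 'M[R]_n) : (A + B) i j = A i j + B i j by rewrite mxE.
by rewrite /direction f e.
Qed.

Lemma descent_stepE J i j :
  descent_step J i j = J i j - ((n%:R * l%:R) ^+ 2)^-1 * direction J i j.
Proof.
have e (a : R) (B : 'M[R]_n) : (a *: B) i j = a * B i j by rewrite mxE.
by rewrite /descent_step subr_mxE e.
Qed.

Lemma iterate_symm k : symm (iterate k) /\ forall i, iterate k i i = 0.
Proof.
elim: k => [|k [IHs IHd]]; first by split=> [i j|i]; rewrite !mxE.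
rewrite /iterate /= -/(iterate k).
split=> [i j|i]; rewrite !descent_stepE !directionE.
  by rewrite IHs (grad_symm _ i j) (penalty_symm M IHs i j).
by rewrite !mxE eqxx IHd !mul0r mulr0 addr0 mulr0 subr0.
Qed.

Lemma num_steps_gt0 : 0 < num_steps%:R :> R.
Proof. by rewrite ltr0n muln_gt0 !expn_gt0 n0 l0. Qed.

Lemma estimate_symm : symm estimate.
Proof.
move=> i j; rewrite !mxE !summxE; congr (_ * _); apply: eq_bigr => k _.
by apply: clip_symm; have [] := iterate_symm k.
Qed.

Lemma estimate_diag i : estimate i i = 0.
Proof.
rewrite mxE summxE big1 ?mulr0 // => k _.
by apply: clip_diag; have [] := iterate_symm k.
Qed.

Lemma estimate_rows : rows_le M estimate.
Proof.
move=> i; apply: (@le_trans _ _ (num_steps%:R^-1 *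
   \sum_(k < num_steps) \sum_j `|clip M (iterate k) i j|)).
  rewrite exchange_big mulr_sumr; apply: ler_sum => j _ /=.
  rewrite mxE summxE normrM ger0_norm ?invr_ge0 ?ler0n //.
  by apply: ler_wpM2l; [rewrite invr_ge0|apply: ler_norm_sum].
rewrite mulrC ler_pdivrMr ?num_steps_gt0 //.
have h (k : 'I_num_steps) : \sum_j `|clip M (iterate k) i j| <= M.
  exact: (clip_rows M0 (iterate k) i).
apply: le_trans (ler_sum _ (fun k _ => h k)) _.
by rewrite sumr_const card_ord mulr_natr.
Qed.

Variable J0 : 'M[R]_n.
Hypotheses (J0s : symm J0) (J0d : forall i, J0 i i = 0) (J0r : rows_le M J0).
Hypothesis large : 2 * M <= (n * l)%:R.

Let nl0 : (0 < n * l)%N. Proof. by rewrite muln_gt0 n0. Qed.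

Let small_field B x i : rows_le M B -> `|2 * mv B (sx R x) i| <= (n * l)%:R.
Proof.
move=> Br; rewrite normrM ger0_norm //; apply: le_trans large.
by rewrite ler_pM2l // norm_mv_sx_le.
Qed.

Lemma norm_bias_le B x i : rows_le M B -> `|bias B x i| <= 2.
Proof.
move=> Br; apply: le_trans (ler_normB _ _) _; rewrite norm_sx.
have := norm_tanh_approx_le1 nl0 (small_field x i Br); lra.
Qed.

Lemma norm_grad_le B i j : rows_le M B -> `|grad B i j| <= 4 * l%:R.
Proof.
move=> Br; rewrite mxE; case: ifP => _; first by rewrite normr0 mulr_ge0.
apply: le_trans (ler_norm_sum _ _ _) _.
have h t : `|bias B (X t) i * sx R (X t) j + bias B (X t) j * sx R (X t) i| <= 4.
  apply: le_trans (ler_normD _ _) _; rewrite !normrM !norm_sx !mulr1.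
  have := norm_bias_le (X t) i Br; have := norm_bias_le (X t) j Br; lra.
apply: le_trans (ler_sum _ (fun t _ => h t)) _.
by rewrite sumr_const card_ord -[leLHS]mulr_natr.
Qed.

(** The derivative at B, along B - J0, of the negative log pseudo-likelihood of
    the sample, with the approximate tanh. *)
Definition loss_slope B : R := \sum_(t < l) dot (bias B (X t))
  (fun i => mv B (sx R (X t)) i - mv J0 (sx R (X t)) i).

Lemma ip_grad B : symm B -> (forall i, B i i = 0) ->
  ip (grad B) (fun i j => B i j - J0 i j) = 2 * loss_slope B.
Proof.
move=> Bs Bd; pose D i j := B i j - J0 i j.
have Dd i : D i i = 0 by rewrite /D Bd J0d subrr.
have Ds i j : D i j = D j i by rewrite /D Bs J0s.
have -> : ip (grad B) (fun i j => B i j - J0 i j) = \sum_(t < l) \sum_i \sum_j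
    (bias B (X t) i * sx R (X t) j * D i j + bias B (X t) j * sx R (X t) i * D i j).
  rewrite [RHS]exchange_big; apply: eq_bigr => i _ /=.
  rewrite [RHS]exchange_big; apply: eq_bigr => j _ /=.
  rewrite mxE; case: eqP => [->|_].
    by rewrite mul0r big1 // => t _; rewrite Dd !mulr0 addr0.
  by rewrite mulr_suml; apply: eq_bigr => t _; rewrite mulrDl.
rewrite /loss_slope mulr_sumr; apply: eq_bigr => t _.
under eq_bigr do rewrite big_split.
rewrite big_split /= [X in _ + X]exchange_big /= mulr_natl mulr2n; congr (_ + _).
  apply: eq_bigr => i _; rewrite -sumrB mulr_sumr; apply: eq_bigr => j _.
  by rewrite /D; ring.
apply: eq_bigr => i _; rewrite -sumrB mulr_sumr; apply: eq_bigr => j _.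
by rewrite Ds /D; ring.
Qed.

(** Replacing J by its clipped version in the inner product with the gradient
    costs at most 4 l times the l1 displacement, that is 8 l times the total
    excess, which is what the penalty returns. *)
Lemma ip_direction_ge J : symm J -> (forall i, J i i = 0) ->
  2 * loss_slope (clip M J) <= ip (direction J) (fun i j => J i j - J0 i j).
Proof.
move=> Js Jd.
have cr := clip_rows M0 J.
have -> : ip (direction J) (fun i j => J i j - J0 i j) =
  ip (grad (clip M J)) (fun i j => clip M J i j - J0 i j) +
  ip (grad (clip M J)) (fun i j => J i j - clip M J i j) +
  4 * l%:R * ip (penalty M J) (fun i j => J i j - J0 i j).
  rewrite /ip mulr_sumr -!big_split /=; apply: eq_bigr => i _.
  rewrite mulr_sumr -!big_split /=; apply: eq_bigr => j _.
  by rewrite directionE; ring.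
rewrite ip_grad; [|exact: clip_symm|exact: clip_diag].
have l4 : 0 <= 4 * l%:R :> R by rewrite mulr_ge0.
have h1 := ler_wpM2l l4 (penalty_ge Js J0s J0r).
have h2 : - (4 * l%:R * \sum_i \sum_j `|J i j - clip M J i j|) <=
    ip (grad (clip M J)) (fun i j => J i j - clip M J i j).
  rewrite lerNl -[X in X <= _]mulN1r /ip mulr_sumr mulr_sumr; apply: ler_sum => i _.
  rewrite mulr_sumr mulr_sumr; apply: ler_sum => j _; rewrite mulN1r.
  apply: le_trans (ler_norm _) _; rewrite normrN normrM.
  by apply: ler_wpM2r => //; apply: norm_grad_le.
have h3 := ler_wpM2l l4 (clip_l1_le M0 Js).
lra.
Qed.

Lemma frob2_direction_le J : frob2 (direction J) <= 144 * n%:R ^+ 2 * l%:R ^+ 2.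
Proof.
have h i j : direction J i j ^+ 2 <= (12 * l%:R) ^+ 2.
  apply: ler_sqr_norm; rewrite directionE.
  apply: le_trans (ler_normD _ _) _; rewrite [`|4 * _ * _|]normrM.
  rewrite (ger0_norm (x := 4 * l%:R)) ?mulr_ge0 //.
  have := norm_grad_le i j (clip_rows M0 J).
  have : 4 * l%:R * `|penalty M J i j| <= 4 * l%:R * 2.
    by apply: ler_wpM2l; rewrite ?mulr_ge0 ?norm_penalty_le.
  lra.
apply: le_trans (ler_sum _ (fun i _ => ler_sum _ (fun j _ => h i j))) _.
under eq_bigr do rewrite sumr_const card_ord.
rewrite sumr_const card_ord -mulrnA -[leLHS]mulr_natl natrM; lra.
Qed.

Lemma descent_progress J : symm J -> (forall i, J i i = 0) ->
  4 * loss_slope (clip M J) <=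
  (n%:R * l%:R) ^+ 2 * (frob2 (J - J0) - frob2 (descent_step J - J0)) + 144.
Proof.
move=> Js Jd; set N := (n%:R * l%:R) ^+ 2.
have N0 : 0 < N by rewrite exprn_gt0 // mulr_gt0.
have E : frob2 (descent_step J - J0) = frob2 (J - J0)
    - 2 * N^-1 * ip (direction J) (fun i j => J i j - J0 i j) + N^-1 ^+ 2 * frob2 (direction J).
  rewrite /frob2 /ip !mulr_sumr -sumrB -big_split /=; apply: eq_bigr => i _.
  rewrite !mulr_sumr -sumrB -big_split /=; apply: eq_bigr => j _.
  have -> : (descent_step J - J0) i j = J i j - N^-1 * direction J i j - J0 i j.
    by rewrite -descent_stepE !mxE.
  have -> : (J - J0) i j = J i j - J0 i j by rewrite !mxE.
  by ring.
have -> : N * (frob2 (J - J0) - frob2 (descent_step J - J0)) =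
    2 * ip (direction J) (fun i j => J i j - J0 i j) - N^-1 * frob2 (direction J).
  by rewrite E; field; rewrite gt_eqF.
have h1 := ip_direction_ge Js Jd.
have h2 : N^-1 * frob2 (direction J) <= 144.
  rewrite mulrC ler_pdivrMr //; apply: le_trans (frob2_direction_le J) _.
  by rewrite /N; lra.
lra.
Qed.

Lemma frob2_rows_le k B : rows_le k B -> frob2 B <= n%:R * k ^+ 2.
Proof.
move=> Br; have h i : \sum_j B i j ^+ 2 <= k ^+ 2.
  apply: (@le_trans _ _ (\sum_j `|B i j| * k)).
    apply: ler_sum => j _; rewrite -real_normK ?num_real // expr2.
    by apply: ler_wpM2l => //; apply: entry_le_rows.
  rewrite -mulr_suml expr2; apply: ler_wpM2r (Br i).
  by apply: le_trans (Br i); apply: sumr_ge0.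
apply: le_trans (ler_sum _ (fun i _ => h i)) _.
by rewrite sumr_const card_ord mulr_natl.
Qed.

(** The progress inequality telescopes; with n^3 l^2 steps the initial
    squared distance, at most n M^2, contributes M^2 / 4 per step. *)
Lemma regret_le :
  \sum_(k < num_steps) loss_slope (clip M (iterate k)) <=
  num_steps%:R * (M ^+ 2 / 4 + 36).
Proof.
set N := (n%:R * l%:R) ^+ 2 : R.
have tel T : \sum_(k < T) (4 * loss_slope (clip M (iterate k))) <=
   N * (frob2 J0 - frob2 (iterate T - J0)) + T%:R * 144.
  elim: T => [|T IH].
    rewrite big_ord0 mul0r addr0.
    have -> : frob2 (iterate 0 - J0) = frob2 J0.
      apply: eq_bigr => i _; apply: eq_bigr => j _.
      by rewrite /iterate /= !mxE sub0r sqrrN.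
    by rewrite subrr mulr0.
  have [Ts Td] := iterate_symm T.
  have := descent_progress Ts Td; rewrite -/N.
  rewrite -[descent_step (iterate T)]/(iterate T.+1).
  move: (frob2 (iterate T.+1 - J0)) => F.
  rewrite big_ord_recr /= -[T.+1%:R]natr1; lra.
have := tel num_steps; rewrite -mulr_sumr.
have N0 : 0 <= N by rewrite exprn_ge0 // mulr_ge0.
have h1 := ler_wpM2l N0 (frob2_rows_le J0r).
have h2 := mulr_ge0 N0 (frob2_ge0 (iterate num_steps - J0)).
have h3 : N * (n%:R * M ^+ 2) = num_steps%:R * M ^+ 2.
  by rewrite /N /num_steps natrM !natrX; ring.
rewrite h3 in h1; lra.
Qed.

Let kappa := expR (- (6 * M)).

(** bias = - resid at J0, plus the increment of tanh from J0 to B, which gives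
    the square term, plus the approximation error. *)
Lemma loss_slope_ge B : rows_le M B ->
  - \sum_(t < l) contrast J0 kappa (B - J0) (X t) - 16 * M ^+ 3 <= loss_slope B.
Proof.
move=> Br.
have h t : - contrast J0 kappa (B - J0) (X t) - 16 * M ^+ 3 / l%:R <=
    dot (bias B (X t)) (fun i => mv B (sx R (X t)) i - mv J0 (sx R (X t)) i).
  set x := X t.
  have mvD i : mv (B - J0) (sx R x) i = mv B (sx R x) i - mv J0 (sx R x) i.
    by rewrite /mv -sumrB; apply: eq_bigr => j _; rewrite !mxE mulrBl.
  have -> : - contrast J0 kappa (B - J0) x - 16 * M ^+ 3 / l%:R =
     \sum_i (- (resid J0 x i * mv (B - J0) (sx R x) i - kappa * mv (B - J0) (sx R x) i ^+ 2)
             - 16 * M ^+ 3 / (n%:R * l%:R)).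
    rewrite sumrB sumr_const card_ord sumrN sumrB -mulr_sumr.
    rewrite /contrast /dot /sqn; congr (_ - _); rewrite -[RHS]mulr_natl.
    by field; rewrite !gt_eqF.
  apply: ler_sum => i _; rewrite mvD.
  set u := mv B _ i; set u0 := mv J0 _ i.
  have uM : `|u| <= M by apply: norm_mv_sx_le.
  have u0M : `|u0| <= M by apply: norm_mv_sx_le.
  have m := tanhR_monotone u0M uM; rewrite -/kappa in m.
  have e := tanh_approx_error nl0 (small_field x i Br); rewrite -/u in e.
  have e' : - (16 * M ^+ 3 / (n%:R * l%:R)) <= (tanh_approx (n * l) u - tanhR u) * (u - u0).
    rewrite lerNl; apply: le_trans (ler_norm _) _; rewrite normrN normrM.
    apply: (@le_trans _ _ (8 * M ^+ 2 / (n * l)%:R * (2 * M))).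
      apply: ler_pM => //.
        apply: le_trans e _; apply: ler_wpM2r; first by rewrite invr_ge0.
        by apply: ler_wpM2l => //; apply: ler_sqr_norm.
      apply: le_trans (ler_normB _ _) _; lra.
    rewrite natrM le_eqVlt; apply/orP; left; apply/eqP.
    by field; rewrite !gt_eqF.
  have -> : bias B x i = (tanh_approx (n * l) u - tanhR u) + (tanhR u - tanhR u0) - resid J0 x i.
    by rewrite /bias /resid -/u -/u0; ring.
  lra.
apply: (@le_trans _ _ (\sum_(t < l) (- contrast J0 kappa (B - J0) (X t)
   - 16 * M ^+ 3 / l%:R))); last by apply: ler_sum => t _.
by rewrite sumr_sub_cst sumrN [l%:R * _]mulrC divfK ?gt_eqF.
Qed.

(** Convexity of the squared Frobenius distance. *)
Lemma estimate_error_le :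
  num_steps%:R * frob2 (estimate - J0) <=
  \sum_(k < num_steps) frob2 (clip M (iterate k) - J0).
Proof.
have T0 := num_steps_gt0.
rewrite /frob2 [leRHS]exchange_big mulr_sumr /=; apply: ler_sum => i _.
rewrite [leRHS]exchange_big mulr_sumr /=; apply: ler_sum => j _.
have -> : (estimate - J0) i j =
   num_steps%:R^-1 * \sum_(k < num_steps) 1 * (clip M (iterate k) - J0) i j.
  rewrite (eq_bigr (fun k : 'I_num_steps => clip M (iterate k) i j - J0 i j)); last first.
    by move=> k _; rewrite mul1r !mxE.
  rewrite sumrB sumr_const card_ord -[J0 i j *+ _]mulr_natl mulrBr mulKf ?gt_eqF //.
  by rewrite [LHS]mxE [estimate i j]mxE summxE [(- J0) i j]mxE.
have := weighted_cauchy_schwarz (fun k : 'I_num_steps => (clip M (iterate k) - J0) i j)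
   (fun=> ler01).
rewrite sumr_const card_ord exprMn mulrA => h.
under [leRHS]eq_bigr do rewrite -[_ ^+ 2]mul1r.
rewrite -(ler_pM2l T0).
have -> : num_steps%:R * (num_steps%:R * (num_steps%:R^-1 ^+ 2) *
  (\sum_(k < num_steps) 1 * (clip M (iterate k) - J0) i j) ^+ 2) =
  (\sum_(k < num_steps) 1 * (clip M (iterate k) - J0) i j) ^+ 2.
  by field; rewrite gt_eqF.
exact: h.
Qed.

Lemma average_contrast_ge :
  - \sum_(k < num_steps) \sum_(t < l) contrast J0 kappa (clip M (iterate k) - J0) (X t)
  <= num_steps%:R * (M ^+ 2 / 4 + 36 + 16 * M ^+ 3).
Proof.
have h (k : 'I_num_steps) := loss_slope_ge (clip_rows M0 (iterate k)).
have : \sum_(k < num_steps)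
    (- \sum_(t < l) contrast J0 kappa (clip M (iterate k) - J0) (X t) - 16 * M ^+ 3) <=
  \sum_(k < num_steps) loss_slope (clip M (iterate k)) by apply: ler_sum.
rewrite sumr_sub_cst sumrN; have := regret_le; lra.
Qed.

End Descent.

(** * Compiling sums, products and branches to the machine *)

Section Compiler.
Variable R : realType.
Notation memory := (nat -> nat -> nat -> R).
Implicit Types (s : state R) (m : memory) (rho : nat -> nat).

Inductive binop := OpAdd | OpSub | OpMul | OpDiv.

(** The index of a sum or product at nesting depth d is variable d, and only
    variables 0 and 1, which hold n and l, may serve as its bound: hence the cost
    is polynomial by construction. *)
Inductive hexpr :=
| HBase of rexpr
| HBin of binop & hexpr & hexpr
| HBig of bool & nat & hexpr
| HIf of hexpr & hexpr & hexpr & hexpr.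

Definition op_rexpr o := match o with
  | OpAdd => RAdd | OpSub => RSub | OpMul => RMul | OpDiv => RDiv end.

Definition op_val o (x y : R) : R := match o with
  | OpAdd => x + y | OpSub => x - y | OpMul => x * y | OpDiv => x / y end.

Definition upd rho v k : nat -> nat := fun w => if w == v then k else rho w.

Fixpoint heval (d : nat) rho m (e : hexpr) : R :=
  match e with
  | HBase r => reval (State rho m) r
  | HBin o x y => op_val o (heval d rho m x) (heval d rho m y)
  | HBig true b x => \prod_(i < rho b) heval d.+1 (upd rho d i) m x
  | HBig false b x => \sum_(i < rho b) heval d.+1 (upd rho d i) m x
  | HIf x y z w => if heval d rho m x <= heval d rho m y
                   then heval d rho m z else heval d rho m w
  end.

Fixpoint iwf (d : nat) (e : iexpr) : bool :=
  match e with
  | IVar v => (v < d)%N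
  | ILit _ => true
  | IAdd x y | ISub x y => iwf d x && iwf d y
  end.

(** ok tells which arrays may be read. *)
Fixpoint rwf (ok : pred nat) (d : nat) (e : rexpr) : bool :=
  match e with
  | RCell A i j => [&& ok A, iwf d i & iwf d j]
  | ROfNat i => iwf d i
  | RAdd x y | RSub x y | RMul x y | RDiv x y => rwf ok d x && rwf ok d y
  end.

Fixpoint hwf (ok : pred nat) (d : nat) (e : hexpr) : bool :=
  match e with
  | HBase r => rwf ok d r
  | HBin _ x y => hwf ok d x && hwf ok d y
  | HBig _ b x => (b < 2)%N && hwf ok d.+1 x
  | HIf x y z w => [&& hwf ok d x, hwf ok d y, hwf ok d z & hwf ok d w]
  end.

Lemma ieval_agree d s s' e : (forall v, (v < d)%N -> ivar s' v = ivar s v) ->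
  iwf d e -> ieval s' e = ieval s e.
Proof.
by move=> h; elim: e => //= [x IHx y IHy /andP[/IHx-> /IHy->]|x IHx y IHy /andP[/IHx-> /IHy->]].
Qed.

Lemma reval_agree (ok : pred nat) d s s' e : (forall v, (v < d)%N -> ivar s' v = ivar s v) ->
  (forall A i j, ok A -> rcell s' A i j = rcell s A i j) ->
  rwf ok d e -> reval s' e = reval s e.
Proof.
move=> h hm; elim: e => //=.
- by move=> A i j /and3P[okA wi wj]; rewrite !(ieval_agree h) ?hm.
- by move=> i wi; rewrite (ieval_agree h).
all: by move=> x IHx y IHy /andP[/IHx-> /IHy->].
Qed.

Lemma heval_agree (ok : pred nat) e : forall d rho rho' m m', (2 <= d)%N ->
  (forall v, (v < d)%N -> rho' v = rho v) ->
  (forall A i j, ok A -> m' A i j = m A i j) ->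
  hwf ok d e -> heval d rho' m' e = heval d rho m e.
Proof.
elim: e => /= [r|o x IHx y IHy|mul b x IHx|x IHx y IHy z IHz w IHw] d rho rho' m m' d2 h hm.
- by apply: reval_agree.
- by move=> /andP[wx wy]; rewrite (IHx d rho rho' m m') ?(IHy d rho rho' m m').
- move=> /andP[b2 wx]; rewrite h ?(leq_trans b2) //.
  have E i : heval d.+1 (upd rho' d i) m' x = heval d.+1 (upd rho d i) m x.
    apply: IHx => //; first exact: leqW.
    by move=> v; rewrite ltnS leq_eqVlt /upd => /orP[->//|/[dup] /h ->]; case: eqP.
  by case: mul; apply: eq_bigr => i _; apply: E.
- move=> /and4P[wx wy wz ww].
  by rewrite (IHx d rho rho' m m') ?(IHy d rho rho' m m') ?(IHz d rho rho' m m')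
             ?(IHw d rho rho' m m').
Qed.

(** Array 3 is a stack of temporaries: [hcomp] leaves the value in cell (a, 0)
    and may overwrite only the cells from row a on. *)

Definition tmp a : rexpr := RCell 3 (ILit a) (ILit 0).

Definition pfor v b body : prog :=
  PSeq (PSetI v (ILit 0))
    (PWhile (TNot (TLeI (IVar b) (IVar v)))
       (PSeq body (PSetI v (IAdd (IVar v) (ILit 1))))).

Fixpoint hcomp (d a : nat) (e : hexpr) : prog :=
  match e with
  | HBase r => PSetR 3 (ILit a) (ILit 0) r
  | HBin o x y => PSeq (hcomp d a x) (PSeq (hcomp d a.+1 y)
      (PSetR 3 (ILit a) (ILit 0) (op_rexpr o (tmp a) (tmp a.+1))))
  | HBig mul b x => PSeq (PSetR 3 (ILit a) (ILit 0) (ROfNat (ILit mul)))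
      (pfor d b (PSeq (hcomp d.+1 a.+1 x)
        (PSetR 3 (ILit a) (ILit 0)
           (op_rexpr (if mul then OpMul else OpAdd) (tmp a) (tmp a.+1)))))
  | HIf x y z w => PSeq (hcomp d a x) (PSeq (hcomp d a.+1 y)
      (PIf (TLeR (tmp a) (tmp a.+1)) (hcomp d a z) (hcomp d a w)))
  end.

Fixpoint hcost (N : nat) (e : hexpr) : nat :=
  match e with
  | HBase _ => 1
  | HBin _ x y => (hcost N x + (hcost N y + 1))%N
  | HBig _ _ x => (1 + (2 + N * (hcost N x + 1 + 2)))%N
  | HIf x y z w => (hcost N x + (hcost N y + (hcost N z + hcost N w).+1))%N
  end.

Lemma exec_for (v b : nat) body K tau (P : nat -> state R -> Prop) s :
  b != v -> ivar s b = K ->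
  (forall i s1, (i < K)%N -> P i s1 -> ivar s1 v = i -> ivar s1 b = K ->
    exists t s2, [/\ exec body s1 t s2, (t <= tau)%N, P i.+1 (set_ivar s2 v i.+1),
                     ivar s2 v = i & ivar s2 b = K]) ->
  P 0%N (set_ivar s v 0) ->
  exists t s', [/\ exec (pfor v b body) s t s', (t <= 2 + K * (tau + 2))%N,
                   P K s', ivar s' v = K & ivar s' b = K].
Proof.
move=> bv sb step P0.
have loop j i s1 : (i + j)%N = K -> P i s1 -> ivar s1 v = i -> ivar s1 b = K ->
    exists t s', [/\ exec (PWhile (TNot (TLeI (IVar b) (IVar v)))
      (PSeq body (PSetI v (IAdd (IVar v) (ILit 1))))) s1 t s', (t <= 1 + j * (tau + 2))%N,
                   P K s', ivar s' v = K & ivar s' b = K].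
  elim: j i s1 => [|j IH] i s1 ij Pi vi bK.
    exists 1%N, s1; rewrite addn0 in ij; rewrite ij in Pi vi; split=> //.
    by apply: ExecWhileF; rewrite /= bK vi leqnn.
  have iK : (i < K)%N by rewrite -ij addnS ltnS leq_addr.
  have [t [s2 [ex tt P2 v2 b2]]] := step i s1 iK Pi vi bK.
  have [|||t' [s3 [ex3 tt3 P3 v3 b3]]] := IH i.+1 (set_ivar s2 v i.+1) _ P2 _ _.
  - by rewrite addSnnS.
  - by rewrite /= eqxx.
  - by rewrite /= (negbTE bv).
  exists (t + 1 + t').+1, s3; split=> //.
    apply: ExecWhileT ex3; first by rewrite /= bK vi -ltnNge.
    apply: ExecSeq ex _.
    have -> : i.+1 = ieval s2 (IAdd (IVar v) (ILit 1)) by rewrite /= v2 addn1.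
    exact: ExecSetI.
  by rewrite mulSn; lia.
have [||t [s' [ex tt PK vK bK]]] := loop K 0%N (set_ivar s v 0) erefl P0.
- by rewrite /= eqxx.
- by rewrite /= (negbTE bv).
exists (1 + t)%N, s'; split=> //.
by apply: ExecSeq ex; apply: ExecSetI.
Qed.

Definition preserves (d a : nat) s s' : Prop :=
  (forall v, (v < d)%N -> ivar s' v = ivar s v) /\
  (forall A i j, (A != 3) || (i < a)%N -> rcell s' A i j = rcell s A i j).

Lemma preserves_trans d a s1 s2 s3 :
  preserves d a s1 s2 -> preserves d a s2 s3 -> preserves d a s1 s3.
Proof.
move=> [h1 h2] [h3 h4]; split=> [v vd|A i j Aa]; first by rewrite h3 ?h1.
by rewrite h4 ?h2.
Qed.

Lemma preserves_weaken d d' a a' s s' : (d' <= d)%N -> (a' <= a)%N ->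
  preserves d a s s' -> preserves d' a' s s'.
Proof.
move=> dd aa [h1 h2]; split=> [v vd|A i j Aa]; first by rewrite h1 // (leq_trans vd).
by apply: h2; case/orP: Aa => [->//|ia]; rewrite (leq_trans ia) ?orbT.
Qed.

Lemma preserves_tmp d a s r : preserves d a s (set_rcell s 3 a 0 r).
Proof.
split=> //= A i j; case: eqP => //= ->; case: eqP => //= ->.
by rewrite ltnn.
Qed.

Lemma set_tmpE s a r : rcell (set_rcell s 3 a 0 r) 3 a 0 = r.
Proof. by rewrite /= !eqxx. Qed.

Section Correctness.
Variables (ok : pred nat) (N : nat).
Hypothesis ok3 : ok 3 = false.

Let ok_frame d a s s' : preserves d a s s' ->
  forall A i j, ok A -> rcell s' A i j = rcell s A i j.
Proof. by move=> [_ h] A i j okA; apply: h; case: eqP okA => // ->; rewrite ok3. Qed.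

Let heval_preserved d a s s' e : (2 <= d)%N -> preserves d a s s' -> hwf ok d e ->
  heval d (ivar s') (rcell s') e = heval d (ivar s) (rcell s) e.
Proof.
by move=> d2 p w; apply: heval_agree w => //; [case: p|apply: ok_frame p].
Qed.

Let op_exec o s a x y : rcell s 3 a 0 = x -> rcell s 3 a.+1 0 = y ->
  exec (PSetR 3 (ILit a) (ILit 0) (op_rexpr o (tmp a) (tmp a.+1))) s 1
       (set_rcell s 3 a 0 (op_val o x y)).
Proof.
move=> <- <-.
have -> : op_val o (rcell s 3 a 0) (rcell s 3 a.+1 0) =
  reval s (op_rexpr o (tmp a) (tmp a.+1)) by case: o.
exact: (ExecSetR s 3 (ILit a) (ILit 0)).
Qed.

Lemma hcomp_correct e : forall d a s, (2 <= d)%N -> hwf ok d e ->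
  (ivar s 0 <= N)%N -> (ivar s 1 <= N)%N ->
  exists t s', [/\ exec (hcomp d a e) s t s', (t <= hcost N e)%N,
    preserves d a s s' & rcell s' 3 a 0 = heval d (ivar s) (rcell s) e].
Proof.
elim: e => [r|o x IHx y IHy|mul b x IHx|x IHx y IHy z IHz w IHw] d a s d2 /= wf s0 s1.
- exists 1%N, (set_rcell s 3 a 0 (reval s r)); split=> //.
  + exact: (ExecSetR s 3 (ILit a) (ILit 0)).
  + exact: preserves_tmp.
  + by rewrite set_tmpE; apply: reval_agree wf.
- case/andP: wf => wx wy.
  have [t1 [s2 [e1 c1 p1 v1]]] := IHx d a s d2 wx s0 s1.
  have i2 v : (v < 2)%N -> ivar s2 v = ivar s v.
    by move=> v2; case: p1 => + _; apply; apply: leq_trans d2.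
  have [||t2 [s3 [e2 c2 p2 v2]]] := IHy d a.+1 s2 d2 wy; rewrite ?i2 //.
  exists (t1 + (t2 + 1))%N, (set_rcell s3 3 a 0
    (op_val o (heval d (ivar s) (rcell s) x) (heval d (ivar s) (rcell s) y))); split.
  + apply: ExecSeq e1 _; apply: ExecSeq e2 _; apply: op_exec.
      by case: p2 => _ ->; rewrite ?ltnSn ?orbT.
    by rewrite v2 (heval_preserved d2 p1).
  + by rewrite !leq_add.
  + apply: preserves_trans p1 _; apply: preserves_trans (preserves_tmp _ _ _ _).
    exact: preserves_weaken p2.
  + exact: set_tmpE.
- case/andP: wf => b2 wx; set K := ivar s b.
  have KN : (K <= N)%N by rewrite /K; move: b2; rewrite ltnS leq_eqVlt ltnS leqn0 => /orP[] /eqP ->.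
  have bd : (b < d)%N by apply: leq_trans d2.
  pose o := if mul then OpMul else OpAdd.
  pose F i := heval d.+1 (upd (ivar s) d i) (rcell s) x.
  pose P (i : nat) s' := preserves d a s s' /\
    rcell s' 3 a 0 = if mul then \prod_(j < i) F j else \sum_(j < i) F j.
  pose si := set_rcell s 3 a 0 (mul%:R : R).
  have [||||t [s' [ex ct [pr vl] _ _]]] := @exec_for d b (PSeq (hcomp d.+1 a.+1 x)
     (PSetR 3 (ILit a) (ILit 0) (op_rexpr o (tmp a) (tmp a.+1)))) K (hcost N x + 1)%N P si.
  + by rewrite neq_ltn bd.
  + by [].
  + move=> i s1' iK [pi vi] di bi.
    have p1 : preserves d a s s1' by [].
    have j2 v : (v < 2)%N -> ivar s1' v = ivar s v.
      by move=> v2; case: p1 => + _; apply; apply: leq_trans d2.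
    have [|||t [s2 [e2 c2 p2 v2]]] := IHx d.+1 a.+1 s1' _ wx; rewrite ?j2 //; first exact: leqW.
    exists (t + 1)%N, (set_rcell s2 3 a 0 (op_val o (rcell s1' 3 a 0) (rcell s2 3 a.+1 0))).
    have p2' : preserves d a s1' s2 by apply: preserves_weaken p2.
    split.
    * apply: ExecSeq e2 _; apply: op_exec => //.
      by case: p2 => _ ->; rewrite ?ltnSn ?orbT.
    * by rewrite leq_add2r.
    * split.
        have [q1 q2] := preserves_trans (preserves_trans p1 p2')
          (preserves_tmp d a s2 (op_val o (rcell s1' 3 a 0) (rcell s2 3 a.+1 0))).
        split=> [v vd|]; last exact: q2.
        by rewrite /= ltn_eqF // -q1.
      rewrite /= !eqxx /= vi v2.
      have -> : heval d.+1 (ivar s1') (rcell s1') x = F i.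
        apply: heval_agree wx; first exact: leqW.
          move=> v; rewrite ltnS leq_eqVlt /upd => /orP[/eqP->|vd]; first by rewrite eqxx.
          by rewrite (ltn_eqF vd); case: p1 => ->.
        exact: ok_frame p1.
      by rewrite /o; case: (mul) => /=; rewrite big_ord_recr.
    * by case: p2 => -> //.
    * by case: p2 => -> //; apply: leqW.
  + split; last by rewrite /= !eqxx !big_ord0; case: (mul).
    have [q1 q2] := preserves_tmp d a s (mul%:R : R).
    by split=> [v vd|A i j Aa]; [rewrite /= ltn_eqF|apply: q2].
  exists (1 + t)%N, s'; split=> //.
  + by apply: ExecSeq ex; apply: (ExecSetR s 3 (ILit a) (ILit 0) (ROfNat (ILit mul))).
  + rewrite leq_add2l (leq_trans ct) // leq_add2l.
    by rewrite leq_mul2r KN orbT.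
- case/and4P: wf => wx wy wz ww.
  have [t1 [s2 [e1 c1 p1 v1]]] := IHx d a s d2 wx s0 s1.
  have i2 v : (v < 2)%N -> ivar s2 v = ivar s v.
    by move=> v2; case: p1 => + _; apply; apply: leq_trans d2.
  have [||t2 [s3 [e2 c2 p2 v2]]] := IHy d a.+1 s2 d2 wy; rewrite ?i2 //.
  have p13 : preserves d a s s3 by apply: preserves_trans p1 _; apply: preserves_weaken p2.
  have i3 v : (v < 2)%N -> ivar s3 v = ivar s v.
    by move=> vlt; case: p13 => + _; apply; apply: leq_trans d2.
  have tE : teval s3 (TLeR (tmp a) (tmp a.+1)) =
     (heval d (ivar s) (rcell s) x <= heval d (ivar s) (rcell s) y).
    rewrite /= v2 (heval_preserved d2 p1) //.
    by case: p2 => _ ->; rewrite ?ltnSn ?orbT // v1.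
  rewrite -tE; case: ifP => T.
    have [||t3 [s4 [e3 c3 p3 v3]]] := IHz d a s3 d2 wz; rewrite ?i3 //.
    exists (t1 + (t2 + t3.+1))%N, s4; split.
    + by apply: ExecSeq e1 _; apply: ExecSeq e2 _; apply: ExecIfT.
    + by move: c1 c2 c3; lia.
    + exact: preserves_trans p3.
    + by rewrite v3 (heval_preserved d2 p13).
  have [||t3 [s4 [e3 c3 p3 v3]]] := IHw d a s3 d2 ww; rewrite ?i3 //.
  exists (t1 + (t2 + t3.+1))%N, s4; split.
  + by apply: ExecSeq e1 _; apply: ExecSeq e2 _; apply: ExecIfF => //; rewrite T.
  + by move: c1 c2 c3; lia.
  + exact: preserves_trans p3.
  + by rewrite v3 (heval_preserved d2 p13).
Qed.

End Correctness.

(** CMat A e updates a whole matrix.  As e may not read A, the order of the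
    assignments to the entries is immaterial. *)
Inductive cmd :=
| CMat of nat & hexpr
| CSeq of cmd & cmd
| CRep of nat & cmd.

Fixpoint denote (d : nat) rho (c : cmd) m : memory :=
  match c with
  | CMat A e => fun A' i j =>
      if [&& A' == A, (i < rho 0)%N & (j < rho 0)%N]
      then heval d.+2 (upd (upd rho d i) d.+1 j) m e else m A' i j
  | CSeq c1 c2 => denote d rho c2 (denote d rho c1 m)
  | CRep b c1 => iteri (rho b) (fun i => denote d.+1 (upd rho d i) c1) m
  end.

Definition readable A : pred nat := fun B => (B != 3) && (B != A).

Fixpoint cwf (d : nat) (c : cmd) : bool :=
  match c with
  | CMat A e => (A != 3) && hwf (readable A) d.+2 e
  | CSeq c1 c2 => cwf d c1 && cwf d c2
  | CRep b c1 => (b < 2)%N && cwf d.+1 c1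
  end.

Fixpoint ccomp (d : nat) (c : cmd) : prog :=
  match c with
  | CMat A e => pfor d 0 (pfor d.+1 0 (PSeq (hcomp d.+2 0 e)
      (PSetR A (IVar d) (IVar d.+1) (tmp 0))))
  | CSeq c1 c2 => PSeq (ccomp d c1) (ccomp d c2)
  | CRep b c1 => pfor d b (ccomp d.+1 c1)
  end.

Fixpoint ccost (N : nat) (c : cmd) : nat :=
  match c with
  | CMat _ e => (2 + N * ((2 + N * (hcost N e + 1 + 2)) + 2))%N
  | CSeq c1 c2 => (ccost N c1 + ccost N c2)%N
  | CRep _ c1 => (2 + N * (ccost N c1 + 2))%N
  end.

Definition same_mem m m' := forall A i j, A != 3 -> m' A i j = m A i j.

Lemma denote_agree c : forall d rho rho' m m', (2 <= d)%N ->
  (forall v, (v < d)%N -> rho' v = rho v) -> same_mem m m' -> cwf d c ->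
  same_mem (denote d rho c m) (denote d rho' c m').
Proof.
elim: c => [A e|c1 IH1 c2 IH2|b c1 IH1] d rho rho' m m' d2 h hm /=.
- move=> /andP[A3 we] B i j B3 /=; rewrite !h ?(leq_trans _ d2) //.
  case: ifP => _; last exact: hm.
  apply: heval_agree we; first by do 2?apply: leqW.
    move=> v; rewrite /upd ltnS leq_eqVlt => /orP[/eqP->|]; first by rewrite !eqxx.
    rewrite ltnS leq_eqVlt => /orP[/eqP->|vd]; first by rewrite ltn_eqF // eqxx.
    by rewrite !ltn_eqF ?h // ltnS ltnW.
  by move=> B' i' j' /andP[B3' _]; apply: hm.
- by move=> /andP[w1 w2]; apply: IH2 => //; apply: IH1.
- move=> /andP[b2 w1]; rewrite h ?(leq_trans b2) //.
  elim: (rho b) => [|K IHK] //=; apply: IH1 => //; first exact: leqW.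
  by move=> v; rewrite ltnS leq_eqVlt /upd => /orP[->//|/[dup] /h ->]; case: eqP.
Qed.

Lemma ccomp_correct N c : forall d s, (2 <= d)%N -> cwf d c ->
  (ivar s 0 <= N)%N -> (ivar s 1 <= N)%N ->
  exists t s', [/\ exec (ccomp d c) s t s', (t <= ccost N c)%N,
    (forall v, (v < d)%N -> ivar s' v = ivar s v) &
    same_mem (denote d (ivar s) c (rcell s)) (rcell s')].
Proof.
elim: c => [A e|c1 IH1 c2 IH2|b c1 IH1] d s d2 /= wf s0 s1.
- case/andP: wf => A3 we; set n := ivar s 0.
  have ok3 : readable A 3 = false by [].
  have d0 : (0 < d)%N by apply: leq_trans d2.
  pose val i j := heval d.+2 (upd (upd (ivar s) d i) d.+1 j) (rcell s) e.
  (* The rows before i, and row i up to column j, have been assigned. *)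
  pose keep i j s' := (forall v, (v < d)%N -> ivar s' v = ivar s v) /\
    forall B p q, B != 3 -> rcell s' B p q =
      if [&& B == A, (q < n)%N & (p < i)%N || ((p == i) && (q < j)%N)] then val p q
      else rcell s B p q.
  have [||||t [s' [ex ct [k1 k2] _ _]]] := @exec_for d 0 (pfor d.+1 0 (PSeq (hcomp d.+2 0 e)
      (PSetR A (IVar d) (IVar d.+1) (tmp 0)))) n (2 + n * (hcost N e + 1 + 2))%N
      (fun i s' => keep i 0%N s') s.
  + by rewrite neq_ltn d0.
  + by [].
  + move=> i s2 iN ki di zi.
    have [||||t [s3 [ex ct [k1 k2] _ zn]]] := @exec_for d.+1 0 (PSeq (hcomp d.+2 0 e)
      (PSetR A (IVar d) (IVar d.+1) (tmp 0))) n (hcost N e + 1)%N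
      (fun j s' => keep i j s' /\ ivar s' d = i) s2.
    * by [].
    * by [].
    * move=> j s4 jn [[g1 g2] gd] dj zj.
      have i4 v : (v < 2)%N -> ivar s4 v = ivar s v.
        by move=> v2; apply: g1; apply: leq_trans d2.
      have [|||t [s5 [e5 c5 [p5 q5] v5]]] :=
        hcomp_correct (N := N) ok3 0 (s := s4) _ we _ _; rewrite ?i4 //.
      have E : rcell s5 3 0 0 = val i j.
        rewrite v5; apply: heval_agree we; first by do 2?apply: leqW.
          move=> v; rewrite /upd ltnS leq_eqVlt => /orP[/eqP->|]; first by rewrite eqxx.
          rewrite ltnS leq_eqVlt => /orP[/eqP->|vd]; first by rewrite ltn_eqF // eqxx.
          by rewrite !ltn_eqF ?g1 // ltnS ltnW.
        by move=> B p q /andP[B3 BA]; rewrite g2 // (negbTE BA).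
      exists (t + 1)%N, (set_rcell s5 A i j (val i j)); split.
      - apply: ExecSeq e5 _; rewrite -E.
        have -> : set_rcell s5 A i j (rcell s5 3 0 0) =
           set_rcell s5 A (ieval s5 (IVar d)) (ieval s5 (IVar d.+1)) (reval s5 (tmp 0)).
          by rewrite /= !p5 // gd dj.
        exact: ExecSetR.
      - by rewrite leq_add2r.
      - split; last by rewrite /= ltn_eqF // p5 // ltnW.
        split=> [v vd|B p q B3] /=.
          by rewrite ltn_eqF ?p5 ?g1 // (leq_trans vd) // ?leqW // ltnW.
        case: (eqVneq B A) => [BA|BA] /=; last first.
          by rewrite q5 ?B3 // g2 // (negbTE BA).
        case: (eqVneq p i) => [->|pi] /=.
          case: (eqVneq q j) => [->|qj] /=.
            by rewrite ltnn leqnn jn.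
          rewrite q5 ?B3 // g2 // BA eqxx ltnn !eqxx /=.
          by rewrite ltnS (leq_eqVlt q j) (negbTE qj).
        by rewrite q5 ?B3 // g2 // BA eqxx (negbTE pi) /= orbF.
      - by rewrite /= p5.
      - by rewrite /= p5.
    * split; last by rewrite /= ltn_eqF.
      case: ki => g1 g2; split=> [v vd|//].
      by rewrite /= ltn_eqF ?g1 // ltnW.
    case: k1 => g1 g2.
    exists t, s3; split=> //.
    split=> [v vd|B p q B3] /=; first by rewrite ltn_eqF ?g1.
    rewrite g2 //; case: (B == A) => //=; case: (ltnP q n) => //= qn.
    rewrite ltnS ltn0 andbF orbF (leq_eqVlt p i).
    by rewrite ?andbT orbC.
  + by split=> [v vd|B p q B3] /=; [rewrite ltn_eqF|rewrite !ltn0 !andbF].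
  exists t, s'; split=> //.
    apply: leq_trans ct _; rewrite leq_add2l; apply: leq_mul => //.
    by rewrite leq_add2r leq_add2l; apply: leq_mul.
  move=> B p q B3; rewrite k2 //= ltn0 andbF orbF.
  by rewrite [(q < _)%N && _]andbC.
- case/andP: wf => w1 w2.
  have [t1 [s2 [e1 c1' p1 m1]]] := IH1 d s d2 w1 s0 s1.
  have i2 v : (v < 2)%N -> ivar s2 v = ivar s v.
    by move=> v2; apply: p1; apply: leq_trans d2.
  have [||t2 [s3 [e2 c2' p2 m2]]] := IH2 d s2 d2 w2; rewrite ?i2 //.
  exists (t1 + t2)%N, s3; split.
  + exact: ExecSeq e1 e2.
  + exact: leq_add.
  + by move=> v vd; rewrite p2 ?p1.
  + move=> A i j A3; rewrite m2 //.
    by apply: (denote_agree d2 p1 m1 w2).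
- case/andP: wf => b2 w1; set K := ivar s b.
  have KN : (K <= N)%N by rewrite /K; move: b2; rewrite ltnS leq_eqVlt ltnS leqn0 => /orP[] /eqP ->.
  have bd : (b < d)%N by apply: leq_trans d2.
  pose D i := iteri i (fun k => denote d.+1 (upd (ivar s) d k) c1) (rcell s).
  pose P (i : nat) s' := (forall v, (v < d)%N -> ivar s' v = ivar s v) /\
    same_mem (D i) (rcell s').
  have [||||t [s' [ex ct [k1 k2] _ _]]] := @exec_for d b (ccomp d.+1 c1) K (ccost N c1) P s.
  + by rewrite neq_ltn bd.
  + by [].
  + move=> i s2 iK [g1 g2] di bi.
    have i2 v : (v < 2)%N -> ivar s2 v = ivar s v.
      by move=> v2; apply: g1; apply: leq_trans d2.
    have [|||t [s3 [e3 c3 p3 m3]]] := IH1 d.+1 s2 _ w1; rewrite ?i2 //; first exact: leqW.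
    exists t, s3; split=> //; last 2 first.
    * by rewrite p3.
    * by rewrite p3 // leqW.
    split=> [v vd|A p q A3] /=; first by rewrite ltn_eqF // p3 ?g1 // leqW.
    rewrite m3 //; apply: denote_agree w1 _ _ _ A3 => //; first exact: leqW.
    move=> v; rewrite ltnS leq_eqVlt /upd => /orP[/eqP->|vd]; first by rewrite eqxx.
    by rewrite ltn_eqF ?g1.
  + by split=> [v vd|A i j A3] //=; rewrite ltn_eqF.
  exists t, s'; split=> //.
  by apply: leq_trans ct _; rewrite leq_add2l leq_mul2r KN orbT.
Qed.

Definition poly_bounded (f : nat -> nat) :=
  exists c k, forall N, (f N <= c * N.+1 ^ k)%N.

Lemma poly_bounded_cst a : poly_bounded (fun=> a).
Proof. by exists a, 0%N => N; rewrite expn0 muln1. Qed.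

Lemma poly_boundedD f g : poly_bounded f -> poly_bounded g ->
  poly_bounded (fun N => f N + g N)%N.
Proof.
move=> [c [k hf]] [c' [k' hg]]; exists (c + c')%N, (maxn k k') => N.
rewrite mulnDl leq_add //.
  by apply: leq_trans (hf N) _; rewrite leq_mul2l leq_pexp2l ?orbT // leq_maxl.
by apply: leq_trans (hg N) _; rewrite leq_mul2l leq_pexp2l ?orbT // leq_maxr.
Qed.

Lemma poly_boundedM f : poly_bounded f -> poly_bounded (fun N => N * f N)%N.
Proof.
move=> [c [k hf]]; exists c, k.+1 => N.
by rewrite expnS mulnCA leq_mul.
Qed.

Lemma poly_bounded_hcost e : poly_bounded (hcost ^~ e).
Proof.
elim: e => [r|o x IHx y IHy|mul b x IHx|x IHx y IHy z IHz w IHw] /=.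
- exact: poly_bounded_cst.
- exact: poly_boundedD IHx (poly_boundedD IHy (poly_bounded_cst _)).
- have H := poly_boundedD (poly_boundedD IHx (poly_bounded_cst 1)) (poly_bounded_cst 2).
  exact: poly_boundedD (poly_bounded_cst 1) (poly_boundedD (poly_bounded_cst 2) (poly_boundedM H)).
- have H := poly_boundedD (poly_bounded_cst 1) (poly_boundedD IHz IHw).
  exact: poly_boundedD IHx (poly_boundedD IHy H).
Qed.

Lemma poly_bounded_ccost c : poly_bounded (ccost ^~ c).
Proof.
elim: c => [A e|c1 IH1 c2 IH2|b c1 IH1] /=.
- have H := poly_boundedD (poly_boundedD (poly_bounded_hcost e) (poly_bounded_cst 1))
              (poly_bounded_cst 2).
  have H' := poly_boundedD (poly_boundedD (poly_bounded_cst 2) (poly_boundedM H))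
              (poly_bounded_cst 2).
  exact: poly_boundedD (poly_bounded_cst 2) (poly_boundedM H').
- exact: poly_boundedD IH1 IH2.
- have H := poly_boundedD IH1 (poly_bounded_cst 2).
  exact: poly_boundedD (poly_bounded_cst 2) (poly_boundedM H).
Qed.

End Compiler.

(** * The estimator as a program *)

(** Arrays: 0 parameters, 1 samples, 2 running average, 4 current iterate,
    5 and 6 staging areas for simultaneous assignment. *)

Definition ilit k : hexpr := HBase (ROfNat (ILit k)).
Definition ivr v : hexpr := HBase (ROfNat (IVar v)).
Definition cell A v w : hexpr := HBase (RCell A (IVar v) (IVar w)).
Definition hM : hexpr := HBase (RCell 0 (ILit 0) (ILit 0)).
Definition hadd := HBin OpAdd.
Definition hsub := HBin OpSub.
Definition hmul := HBin OpMul.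
Definition hdiv := HBin OpDiv.
Definition habs x := HIf (ilit 0) x x (hsub (ilit 0) x).
Definition hnl : hexpr := hmul (ivr 0) (ivr 1).

Definition hrow v d := HBig false 0 (habs (cell 4 v d)).
Definition hshrink v d := HIf (hrow v d) hM (ilit 1) (hdiv hM (hrow v d)).
Definition hviolated v d := HIf (hrow v d) hM (ilit 0) (ilit 1).
Definition hclip v w d := hmul (hmul (cell 4 v w) (hshrink v d)) (hshrink w d).
Definition hpenalty v w d := hmul (hdiv (cell 4 v w) (habs (cell 4 v w)))
  (hadd (hviolated v d) (hviolated w d)).
Definition hfield v t d := HBig false 0 (hmul (hclip v d d.+1) (cell 1 t d)).
Definition htanh v t d :=
  hsub (ilit 1) (hdiv (ilit 2) (hadd
    (HBig true 0 (HBig true 1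
       (hadd (ilit 1) (hdiv (hmul (ilit 2) (hfield v t d.+2)) hnl))))
    (ilit 1))).
Definition hbias v t d := hsub (htanh v t d) (cell 1 t v).
Definition hgradsum v w d := HBig false 1
  (hadd (hmul (hbias v d d.+1) (cell 1 d w)) (hmul (hbias w d d.+1) (cell 1 d v))).
Definition hgrad v w d :=
  HIf (ivr v) (ivr w) (HIf (ivr w) (ivr v) (ilit 0) (hgradsum v w d)) (hgradsum v w d).
Definition hstep v w d := hsub (cell 4 v w)
  (hmul (hdiv (ilit 1) (hmul hnl hnl))
     (hadd (hgrad v w d) (hmul (hmul (ilit 4) (ivr 1)) (hpenalty v w d)))).
Definition haccum v w d := hadd (cell 2 v w)
  (hmul (hdiv (ilit 1) (hmul (hmul (ivr 0) (hmul (ivr 0) (ivr 0))) (hmul (ivr 1) (ivr 1))))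
     (hclip v w d)).

(** The rows and columns of the matrices are variables 7 and 8, because the body
    lies below five loops, whose indices are variables 2 to 6. *)
Definition descent_body : cmd :=
  CSeq (CMat 6 (haccum 7 8 9)) (CSeq (CMat 2 (cell 6 7 8))
    (CSeq (CMat 5 (hstep 7 8 9)) (CMat 4 (cell 5 7 8)))).

(** The five loops make n^3 l^2 rounds. *)
Definition descent_cmd : cmd :=
  CRep 0 (CRep 0 (CRep 0 (CRep 1 (CRep 1 descent_body)))).

Definition descent_prog : prog := ccomp 2 descent_cmd.

Section ProgramMeaning.
Variables (R : realType) (n l : nat) (M : R) (X : samples l n).
Notation memory := (nat -> nat -> nat -> R).
Implicit Types (m : memory) (rho : nat -> nat) (J : 'M[R]_n).

Definition sizes rho := rho 0%N = n /\ rho 1%N = l.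

Lemma sizes_upd rho d k : (2 <= d)%N -> sizes rho -> sizes (upd rho d k).
Proof. by move=> d2 [h0 h1]; rewrite /sizes /upd !ltn_eqF // ltnW. Qed.

Lemma upd_same rho d k : upd rho d k d = k.
Proof. by rewrite /upd eqxx. Qed.

Lemma upd_below rho d k v : (v < d)%N -> upd rho d k v = rho v.
Proof. by move=> vd; rewrite /upd ltn_eqF. Qed.

Definition inputs m := m 0%N 0%N 0%N = M /\
  forall (t : 'I_l) (i : 'I_n), m 1%N t i = sx R (X t) i.
Definition holds A m J := forall i j : 'I_n, m A i j = J i j.

Section Expressions.
Variables (m : memory) (J : 'M[R]_n).
Hypotheses (inp : inputs m) (mJ : holds 4 m J).

Lemma heval_sum d rho b e K : rho b = K ->
  heval d rho m (HBig false b e) = \sum_(i < K) heval d.+1 (upd rho d i) m e.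
Proof. by move=> <-. Qed.

Lemma heval_prod d rho b e K : rho b = K ->
  heval d rho m (HBig true b e) = \prod_(i < K) heval d.+1 (upd rho d i) m e.
Proof. by move=> <-. Qed.

Lemma heval_abs d rho e : heval d rho m (habs e) = `|heval d rho m e|.
Proof.
rewrite /=; case: (lerP 0 (heval d rho m e)) => h; first by rewrite ger0_norm.
by rewrite sub0r ltr0_norm.
Qed.

Lemma heval_row rho d v (i : 'I_n) : sizes rho -> (v < d)%N -> rho v = i ->
  heval d rho m (hrow v d) = row_norm J i.
Proof.
move=> [s0 _] vd vi; rewrite (heval_sum _ _ s0); apply: eq_bigr => j _.
by rewrite heval_abs /= upd_same upd_below // vi mJ.
Qed.

Lemma heval_shrink rho d v (i : 'I_n) : sizes rho -> (v < d)%N -> rho v = i ->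
  heval d rho m (hshrink v d) = shrink M J i.
Proof.
move=> s vd vi; rewrite /shrink -(heval_row s vd vi) -(proj1 inp).
by [].
Qed.

Lemma heval_violated rho d v (i : 'I_n) : sizes rho -> (v < d)%N -> rho v = i ->
  heval d rho m (hviolated v d) = violated M J i.
Proof.
move=> s vd vi; rewrite /violated -(heval_row s vd vi) -(proj1 inp).
by [].
Qed.

Lemma heval_cell A d rho v w (i j : nat) : rho v = i -> rho w = j ->
  heval d rho m (cell A v w) = m A i j.
Proof. by move=> /= -> ->. Qed.

Lemma heval_bin o d rho e f :
  heval d rho m (HBin o e f) = op_val o (heval d rho m e) (heval d rho m f).
Proof. by []. Qed.

Lemma heval_if d rho x y z w : heval d rho m (HIf x y z w) =
  if heval d rho m x <= heval d rho m y then heval d rho m z else heval d rho m w.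
Proof. by []. Qed.

Lemma heval_clip rho d v w (i j : 'I_n) : sizes rho -> (v < d)%N -> (w < d)%N ->
  rho v = i -> rho w = j -> heval d rho m (hclip v w d) = clip M J i j.
Proof.
move=> s vd wd vi wj; rewrite /hclip 2!heval_bin (heval_shrink s vd vi).
by rewrite (heval_shrink s wd wj) (heval_cell _ _ vi wj) mJ mxE.
Qed.

Lemma heval_penalty rho d v w (i j : 'I_n) : sizes rho -> (v < d)%N -> (w < d)%N ->
  rho v = i -> rho w = j -> heval d rho m (hpenalty v w d) = penalty M J i j.
Proof.
move=> s vd wd vi wj; rewrite /hpenalty !heval_bin (heval_violated s vd vi) heval_abs.
by rewrite (heval_violated s wd wj) (heval_cell _ _ vi wj) mJ mxE.
Qed.

Lemma heval_field rho d v t (i : 'I_n) (k : 'I_l) : (2 <= d)%N -> sizes rho ->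
  (v < d)%N -> (t < d)%N -> rho v = i -> rho t = k ->
  heval d rho m (hfield v t d) = mv (clip M J) (sx R (X k)) i.
Proof.
move=> d2 s vd td vi tk; rewrite (heval_sum _ _ (proj1 s)).
apply: eq_bigr => j _; rewrite heval_bin; congr (_ * _).
  exact: (heval_clip (sizes_upd j d2 s) (leqW vd) (ltnSn d)
    (etrans (upd_below rho j vd) vi) (upd_same rho d j)).
rewrite (heval_cell _ _ (i := k) (j := j)) ?upd_same ?upd_below //.
by case: inp => _ ->.
Qed.

Lemma heval_nl rho d : sizes rho -> heval d rho m hnl = n%:R * l%:R.
Proof. by move=> [s0 s1]; rewrite /= s0 s1. Qed.

Lemma heval_bias rho d v t (i : 'I_n) (k : 'I_l) : (2 <= d)%N -> sizes rho ->
  (v < d)%N -> (t < d)%N -> rho v = i -> rho t = k ->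
  heval d rho m (hbias v t d) = bias l (clip M J) (X k) i.
Proof.
move=> d2 s vd td vi tk; rewrite /hbias /bias heval_bin (heval_cell _ _ tk vi).
case: inp => _ ->; congr (_ - _); rewrite /htanh /tanh_approx !heval_bin.
congr (_ - _ / (_ + _)); rewrite natrM.
rewrite (heval_prod _ _ (proj1 s)).
set F := 1 + _.
rewrite (eq_bigr (fun _ : 'I_n => F ^+ l)).
  by rewrite prodr_const card_ord -exprM mulnC.
move=> a _; rewrite (heval_prod _ _ (proj2 (sizes_upd a d2 s))).
rewrite (eq_bigr (fun _ : 'I_l => F)); first by rewrite prodr_const card_ord.
move=> b _; have s' := sizes_upd b (leqW d2) (sizes_upd a d2 s).
have below u : (u < d)%N -> upd (upd rho d a) d.+1 b u = rho u.
  by move=> ud; rewrite !upd_below // leqW.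
rewrite (heval_bin OpAdd) (heval_bin OpDiv) heval_nl // (heval_bin OpMul).
by rewrite (heval_field (leqW (leqW d2)) s' (leqW (leqW vd)) (leqW (leqW td))
  (etrans (below v vd) vi) (etrans (below t td) tk)).
Qed.

Lemma heval_gradsum rho d v w (i j : 'I_n) : (2 <= d)%N -> sizes rho ->
  (v < d)%N -> (w < d)%N -> rho v = i -> rho w = j ->
  heval d rho m (hgradsum v w d) =
  \sum_(t < l) (bias l (clip M J) (X t) i * sx R (X t) j + bias l (clip M J) (X t) j * sx R (X t) i).
Proof.
move=> d2 s vd wd vi wj; rewrite (heval_sum _ _ (proj2 s)).
apply: eq_bigr => t _; have s' : sizes (upd rho d t) by apply: sizes_upd.
have vi' : upd rho d t v = i by rewrite upd_below.
have wj' : upd rho d t w = j by rewrite upd_below.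
have tt := upd_same rho d t.
rewrite (heval_bin OpAdd) !(heval_bin OpMul) (heval_cell _ _ tt wj') (heval_cell _ _ tt vi').
rewrite (heval_bias (leqW d2) s' (leqW vd) (ltnSn d) vi' tt).
rewrite (heval_bias (leqW d2) s' (leqW wd) (ltnSn d) wj' tt).
by case: inp => _ h; rewrite !h.
Qed.

Lemma heval_grad rho d v w (i j : 'I_n) : (2 <= d)%N -> sizes rho ->
  (v < d)%N -> (w < d)%N -> rho v = i -> rho w = j ->
  heval d rho m (hgrad v w d) = grad X (clip M J) i j.
Proof.
move=> d2 s vd wd vi wj; rewrite mxE -(heval_gradsum d2 s vd wd vi wj).
rewrite /hgrad; move: (hgradsum v w d) => g.
rewrite heval_if heval_if [heval _ _ _ (ivr v)]/((rho v)%:R) [heval _ _ _ (ivr w)]/((rho w)%:R).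
rewrite vi wj !ler_nat -val_eqE /= eqn_leq.
by case: (leqP i j) => //=; case: (leqP j i).
Qed.

Lemma heval_step rho d v w (i j : 'I_n) : (2 <= d)%N -> sizes rho ->
  (v < d)%N -> (w < d)%N -> rho v = i -> rho w = j ->
  heval d rho m (hstep v w d) = descent_step M X J i j.
Proof.
move=> d2 s vd wd vi wj; rewrite descent_stepE directionE /hstep.
rewrite (heval_bin OpSub) (heval_bin OpMul) (heval_bin OpDiv) (heval_bin OpMul _ _ hnl) heval_nl //.
rewrite (heval_bin OpAdd) (heval_bin OpMul).
rewrite (heval_grad d2 s vd wd vi wj) (heval_penalty s vd wd vi wj).
rewrite (heval_cell _ _ vi wj) mJ /= (proj2 s) expr2 mul1r.
by [].
Qed.

Lemma heval_accum S rho d v w (i j : 'I_n) : holds 2 m S -> (2 <= d)%N -> sizes rho ->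
  (v < d)%N -> (w < d)%N -> rho v = i -> rho w = j ->
  heval d rho m (haccum v w d) = S i j + (num_steps n l)%:R^-1 * clip M J i j.
Proof.
move=> mS d2 s vd wd vi wj; rewrite /haccum heval_bin heval_bin.
rewrite (heval_clip s vd wd vi wj) (heval_cell _ _ vi wj) mS /= (proj1 s) (proj2 s) mul1r.
by rewrite /num_steps natrM !natrX; congr (_ + _^-1 * _); ring.
Qed.

End Expressions.

Definition partial_estimate k : 'M[R]_n :=
  (num_steps n l)%:R^-1 *: \sum_(k' < k) clip M (iterate M X k').

Definition descent_inv k m :=
  [/\ inputs m, holds 4 m (iterate M X k) & holds 2 m (partial_estimate k)].

Lemma denote_mat d rho A e m (i j : 'I_n) : rho 0%N = n ->
  denote d rho (CMat A e) m A i j = heval d.+2 (upd (upd rho d i) d.+1 j) m e.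
Proof. by move=> s0; rewrite /= eqxx s0 !ltn_ord. Qed.

Lemma descent_body_correct rho k m : sizes rho -> descent_inv k m ->
  descent_inv k.+1 (denote 7 rho descent_body m).
Proof.
move=> s [inp mJ mS]; have s0 := proj1 s.
have s' (i j : 'I_n) : sizes (upd (upd rho 7 i) 8 j).
  by apply: sizes_upd => //; apply: sizes_upd.
rewrite /descent_body.
set m1 := denote 7 rho (CMat 6 (haccum 7 8 9)) m.
set m2 := denote 7 rho (CMat 2 (cell 6 7 8)) m1.
set m3 := denote 7 rho (CMat 5 (hstep 7 8 9)) m2.
set m4 := denote 7 rho (CMat 4 (cell 5 7 8)) m3.
rewrite -[denote _ _ _ _]/m4.
have inp2 : inputs m2 by case: inp => h1 h2; split.
have mJ2 : holds 4 m2 (iterate M X k) by move=> i j; apply: mJ.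
split.
- by case: inp => h1 h2; split.
- move=> i j; rewrite /m4 denote_mat // (heval_cell _ _ _ (i := i) (j := j)) //.
  rewrite /m3 denote_mat // (heval_step inp2 mJ2 _ (s' i j) _ _ (i := i) (j := j)) //.
- move=> i j; have -> : m4 2%N i j = m2 2%N i j by [].
  rewrite /m2 denote_mat // (heval_cell _ _ _ (i := i) (j := j)) //.
  rewrite /m1 denote_mat // (heval_accum inp mJ mS _ (s' i j) _ _ (i := i) (j := j)) //.
  have e (a : R) (A B : 'M[R]_n) : (a *: (A + B)) i j = (a *: A) i j + a * B i j.
    by rewrite !mxE mulrDr.
  by rewrite /partial_estimate big_ord_recr /= e.
Qed.

(** Counting rounds additively lets the nested loops be handled one at a
    time. *)
Lemma descent_inv_iteri (f : nat -> memory -> memory) c N k m :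
  (forall i k m, descent_inv k m -> descent_inv (k + c)%N (f i m)) ->
  descent_inv k m -> descent_inv (k + N * c)%N (iteri N f m).
Proof.
move=> hf h0; elim: N => [|N IH] /=; first by rewrite mul0n addn0.
by rewrite mulSn addnCA addnC -addnA [(_ * _ + c)%N]addnC addnA addnAC; apply: hf.
Qed.

Lemma descent_cmd_correct rho m : sizes rho -> descent_inv 0 m ->
  descent_inv (num_steps n l) (denote 2 rho descent_cmd m).
Proof.
move=> s h.
have -> : num_steps n l = (0 + n * (n * (n * (l * (l * 1)))))%N.
  by rewrite /num_steps; ring.
rewrite /descent_cmd.
have step d b c e K : (2 <= d)%N -> (forall r, sizes r -> r b = K) ->
  (forall r k m', sizes r -> descent_inv k m' -> descent_inv (k + e)%N (denote d.+1 r c m')) ->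
  forall r k m', sizes r -> descent_inv k m' ->
    descent_inv (k + K * e)%N (denote d r (CRep b c) m').
  move=> d2 bK hc r k m' sr hm; rewrite /= (bK r sr).
  by apply: descent_inv_iteri hm => i k' m''; apply: hc; apply: sizes_upd.
have b0 r : sizes r -> r 0%N = n by case.
have b1 r : sizes r -> r 1%N = l by case.
apply: (step 2 0%N _ _ n) s h => //.
apply: (step 3 0%N _ _ n) => //.
apply: (step 4 0%N _ _ n) => //.
apply: (step 5 1%N _ _ l) => //.
apply: (step 6 1%N _ _ l) => // r k m' sr hm.
by rewrite addn1; apply: descent_body_correct.
Qed.

End ProgramMeaning.

Lemma estimate_poly_time (R : realType) :
  poly_time_computable (fun n l (M _ : R) (X : samples l n) => estimate M X).
Proof.
exists descent_prog.
have [c [k ck]] := poly_bounded_ccost descent_cmd.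
exists c, k => n l M delta X n0 l0 M0 /andP[d0 d1].
set s0 := input_state M delta X.
have wf : cwf 2 descent_cmd by [].
have [||t [s [ex ct _ same]]] := ccomp_correct (N := maxn n l) (s := s0) (isT : (2 <= 2)%N) wf.
- exact: leq_maxl.
- exact: leq_maxr.
exists t, s; split=> //.
  have inv0 : descent_inv M X 0 (rcell s0).
    split.
    - split=> // u i; rewrite /=.
      by rewrite (valK u) (valK i).
    - by move=> i j; rewrite /= mxE.
    - by move=> i j; rewrite /partial_estimate big_ord0 scaler0 mxE.
  have [_ _ h2] := descent_cmd_correct (conj erefl erefl : sizes n l (ivar s0)) inv0.
  by apply/matrixP => i j; rewrite mxE same // h2.
apply: (@le_trans _ _ (c * (maxn n l).+1 ^ k)%:R).
  by rewrite ler_nat (leq_trans ct).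
rewrite natrM natrX; apply: ler_wpM2l => //.
apply: lerXn2r; rewrite ?nnegrE ?ler0n //.
  by rewrite !addr_ge0 ?ler0n ?ltW // ln_gt0 // div1r invf_gt1.
apply: (@le_trans _ _ (n%:R + l%:R)).
  by rewrite -natrD ler_nat; lia.
rewrite -addrA lerDl addr_ge0 ?ltW // ln_gt0 // div1r invf_gt1 //.
Qed.

(** * The rate *)

Section Assembly.
Variable R : realType.

(** In terms of y = exp M: lambda c equals y^(-20) / (4224 k^9) with
    k = 2 + 8M <= 8 y, and the numerator to be covered is at most 104 y^3; so the
    square of the constant must reach 104 * 4224 * 8^9 y^32 < 2^48 y^32. *)
Definition rate_constant (M : R) : R := 2 ^+ 24 * expR (16 * M).

Lemma rate_constant_singly_exponential : singly_exponential rate_constant.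
Proof. by exists (2 ^+ 24), 16; split=> //; rewrite exprn_gt0. Qed.

Lemma rate_constant_sqr M : rate_constant M ^+ 2 = 2 ^+ 48 * expR M ^+ 32.
Proof. by rewrite /rate_constant expRM_natl exprMn -!exprM. Qed.

Section Constants.
Variable M : R.
Hypothesis M0 : 0 < M.
Let kappa := expR (- (6 * M)).
Let lam := mgf_lambda M kappa.
Let c := mgf_rate M kappa.
Let y := expR M.
Let y1 : 1 + M <= y. Proof. exact: expR_ge1Dx. Qed.
Let ygt0 : 0 < y. Proof. exact: expR_gt0. Qed.

Lemma kappa_gt0 : 0 < kappa. Proof. exact: expR_gt0. Qed.
Lemma kappa_le1 : kappa <= 1.
Proof. by rewrite /kappa -[leRHS]expR0 ler_expR; have := M0; lra. Qed.

Let expRNn (m : nat) : expR (- (m%:R * M)) = (y ^+ m)^-1.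
Proof. by rewrite expRN expRM_natl. Qed.

Lemma lam_c_rate : 104 * y ^+ 3 <= lam * c * rate_constant M ^+ 2.
Proof.
have k0 : 0 < 2 + 8 * M by have := M0; lra.
rewrite rate_constant_sqr -/y.
have -> : lam * c * (2 ^+ 48 * y ^+ 32) =
    2 ^+ 48 * y ^+ 12 / (4224 * (2 + 8 * M) ^+ 9).
  rewrite /lam /c /mgf_lambda /mgf_rate /mgf_sigma /kappa !expRNn.
  by field; rewrite !gt_eqF.
rewrite ler_pdivlMr ?mulr_gt0 ?exprn_gt0 //.
have h : (2 + 8 * M) ^+ 9 <= (8 * y) ^+ 9.
  by apply: lerXn2r; rewrite ?nnegrE; have := M0; have := y1; lra.
have y3 : 0 <= y ^+ 3 by rewrite exprn_ge0 // ltW.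
have y12 : 0 <= y ^+ 12 by rewrite exprn_ge0 // ltW.
have e9 : 8 ^+ 9 = 2 ^+ 27 :> R.
  have -> : 8 = 2 ^+ 3 :> R by ring.
  by rewrite -exprM.
have hZ := ler_wpM2l y3 h; rewrite exprMn e9 [leRHS]mulrCA -exprD in hZ.
have Z0 : 0 <= y ^+ 3 * (2 + 8 * M) ^+ 9 by rewrite mulr_ge0 ?exprn_ge0 // ltW.
have -> : 104 * y ^+ 3 * (4224 * (2 + 8 * M) ^+ 9) =
  104 * 4224 * (y ^+ 3 * (2 + 8 * M) ^+ 9) by ring.
have e48 : 2 ^+ 48 = 2 ^+ 21 * 2 ^+ 27 :> R by rewrite -exprD.
have e21 : 2 ^+ 21 = 2 ^+ 8 * 2 ^+ 13 :> R by rewrite -exprD.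
rewrite e48 -[leRHS]mulrA e21; apply: ler_pM => //; first by rewrite mulr_ge0.
have a1 : 104 <= 2 ^+ 8 :> R by lra.
have a2 : 4224 <= 2 ^+ 13 :> R by lra.
by apply: ler_pM.
Qed.

Lemma lam_gt0 : 0 < lam. Proof. exact: mgf_lambda_gt0 M0 kappa_gt0. Qed.
Lemma c_gt0 : 0 < c. Proof. exact: mgf_rate_gt0 M0 kappa_gt0. Qed.

Let sigma_bound : 0 < mgf_sigma M <= 1.
Proof.
have k0 : 0 < 2 + 8 * M by have := M0; lra.
apply/andP; split; first by rewrite divr_gt0 ?expR_gt0 ?mulr_gt0.
rewrite ler_pdivrMr ?mulr_gt0 //.
have : expR (- (2 * M)) <= 1 by rewrite -[leRHS]expR0 ler_expR; have := M0; lra.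
have := M0; lra.
Qed.

Lemma lam_le1 : lam <= 1.
Proof.
have k1 : 1 <= 2 + 8 * M by have := M0; lra.
have /andP[s0 s1] := sigma_bound; have k0 := kappa_gt0.
rewrite /lam /mgf_lambda ler_pdivrMr ?mulr_gt0 ?exprn_gt0 ?(lt_le_trans ltr01 k1) //.
have h6 : 1 <= (2 + 8 * M) ^+ 6 by rewrite expr_ge1 // ?(le_trans ler01).
have h1 : kappa * mgf_sigma M ^+ 2 <= 1.
  by apply: mulr_ile1; rewrite ?kappa_le1 ?exprn_ile1 ?exprn_ge0 // ltW.
lra.
Qed.

Lemma c_le1 : c <= 1.
Proof.
have /andP[s0 s1] := sigma_bound; have k0 := kappa_gt0.
have e1 : expR (- (2 * M)) <= 1 by rewrite -[leRHS]expR0 ler_expR; have := M0; lra.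
rewrite /c /mgf_rate ler_pdivrMr // mul1r.
have h1 : kappa * mgf_sigma M <= 1.
  by apply: mulr_ile1; rewrite ?kappa_le1 // ltW.
have h0 : 0 <= kappa * mgf_sigma M by rewrite mulr_ge0 // ltW.
have : kappa * mgf_sigma M * expR (- (2 * M)) <= 1 by apply: mulr_ile1; rewrite ?expR_ge0.
lra.
Qed.

Lemma poly_le_exp3 : 104 + 32 * M + M ^+ 2 / 2 + 32 * M ^+ 3 <= 104 * y ^+ 3.
Proof.
have m0 : 0 <= M by apply: ltW.
have h : (1 + M) ^+ 3 <= y ^+ 3 by apply: lerXn2r; rewrite ?nnegrE //; have := y1; lra.
have := mulr_ge0 m0 m0; have := mulr_ge0 m0 (mulr_ge0 m0 m0); lra.
Qed.

End Constants.

Lemma ln2_ge : 1 / 2 <= ln 2 :> R.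
Proof.
have h2 : expR (1 / 2) <= 2 :> R.
  have := expR_ge1Dx (- (1 / 2) : R); rewrite expRN => h.
  have p := expR_gt0 (1 / 2 : R).
  have := ler_wpM2l (ltW p) h; rewrite divff ?gt_eqF //; lra.
by rewrite -(expRK (1 / 2)) ler_ln // posrE ?expR_gt0.
Qed.

Lemma frobeniusE n (B : 'M[R]_n) : frobenius B = Num.sqrt (frob2 B).
Proof. by []. Qed.

Lemma frobenius_le n (B : 'M[R]_n) (C W : R) (l : nat) : (0 < l)%N -> 0 <= C -> 0 <= W ->
  l%:R * frob2 B <= C ^+ 2 * W -> frobenius B <= C * Num.sqrt (W / l%:R).
Proof.
move=> l0 C0 W0 h; have lR : 0 < l%:R :> R by rewrite ltr0n.
rewrite -[C in leRHS](ger0_norm C0) -sqrtr_sqr -sqrtrM ?sqr_ge0 // frobeniusE.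
rewrite ler_sqrt; first by rewrite mulrA ler_pdivlMr // mulrC.
by rewrite mulr_ge0 ?sqr_ge0 ?divr_ge0 ?ler0n.
Qed.

Lemma bounded_interactionP n (M : R) (B : 'M[R]_n) : 0 <= M ->
  bounded_interaction M B <-> [/\ symm B, (forall i, B i i = 0) & rows_le M B].
Proof.
move=> M0; split.
  move=> [[Bs Bd] Bn]; split=> // [i j|i]; first by rewrite -{1}Bs mxE.
  by apply: le_trans Bn; rewrite /infnorm; apply: le_bigmax.
move=> [Bs Bd Br]; split; first by split=> //; apply/matrixP => i j; rewrite mxE.
by apply: bigmax_le => // i _; apply: Br.
Qed.

Lemma sumr_sub_cst_scaled m (f : 'I_m -> R) a b :
  \sum_i (a * f i - b) = a * \sum_i f i - m%:R * b.
Proof. by rewrite sumr_sub_cst mulr_sumr. Qed.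

Section Rate.
Variables (n l : nat) (M delta : R) (Jstar : 'M[R]_n).
Hypotheses (M0 : 0 < M) (delta01 : 0 < delta < 1) (n2 : (1 < n)%N) (l0 : (0 < l)%N).
Hypotheses (Js : symm Jstar) (Jd : forall i, Jstar i i = 0) (JM : rows_le M Jstar).

Let nR : 2 <= n%:R :> R. Proof. by rewrite ler_nat. Qed.
Let lR : 1 <= l%:R :> R. Proof. by rewrite ler1n. Qed.
Let W : R := n%:R ^+ 2 * ln (n%:R * l%:R) + ln (1 / delta).

Let L_ge : 1 / 2 <= ln (n%:R * l%:R) :> R.
Proof.
apply: le_trans ln2_ge _; rewrite ler_ln ?posrE //.
  by have := ler_pM (ler0n R 2) ler01 nR lR; rewrite mulr1.
by apply: mulr_gt0; have := nR; have := lR; lra.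
Qed.

Let D_ge0 : 0 <= ln (1 / delta).
Proof.
case/andP: delta01 => d0 d1; apply: ln_ge0.
by rewrite div1r invf_ge1 // ltW.
Qed.

Let n4 : 4 <= n%:R ^+ 2 :> R.
Proof. have := ler_pM (ler0n R 2) (ler0n R 2) nR nR; rewrite -expr2; lra. Qed.

Let main_ge : 2 <= n%:R ^+ 2 * ln (n%:R * l%:R) :> R.
Proof. have := ler_pM (ler0n R 4) _ n4 L_ge; lra. Qed.

Lemma rate_ge0 : 0 <= W.
Proof. have := main_ge; have := D_ge0; rewrite /W; lra. Qed.

(** Every matrix with row sums at most 2M has |B|_F^2 <= 4 n M^2, so fewer than
    2M / n samples call for no estimation. *)
Lemma small_sample_rate (B : 'M[R]_n) : n%:R * l%:R < 2 * M -> rows_le (2 * M) B ->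
  l%:R * frob2 B <= rate_constant M ^+ 2 * W.
Proof.
move=> nl Br.
apply: (@le_trans _ _ (l%:R * (n%:R * (2 * M) ^+ 2))).
  by apply: ler_wpM2l => //; apply: frob2_rows_le.
apply: (@le_trans _ _ (2 * M * (2 * M) ^+ 2)).
  rewrite mulrA; apply: ler_wpM2r; first exact: sqr_ge0.
  by rewrite mulrC ltW.
apply: (@le_trans _ _ (rate_constant M ^+ 2 * 2)); last first.
  apply: ler_wpM2l; first exact: sqr_ge0.
  have := main_ge; have := D_ge0; rewrite /W; lra.
have m0 := ltW M0; have y1 := expR_ge1Dx M.
rewrite rate_constant_sqr; set y := expR M in y1 *.
have y32 : y ^+ 3 <= y ^+ 32 by apply: ler_weXn2l => //; lra.
have h : M ^+ 3 <= y ^+ 3 by apply: lerXn2r; rewrite ?nnegrE //; lra.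
have e48 : 2 ^+ 3 <= 2 ^+ 48 :> R by apply: ler_weXn2l => //; lra.
have y0 : 0 <= y ^+ 3 by rewrite exprn_ge0 //; lra.
have H : 2 ^+ 3 * y ^+ 3 <= 2 ^+ 48 * y ^+ 32 by apply: ler_pM => //; apply: exprn_ge0.
move: H; move: (2 ^+ 48 * y ^+ 32) => Q H; lra.
Qed.

(** The deviation bound, averaged over the iterates, meets the regret bound; what
    remains is a multiple of n^2 log (n l) since n^2 log (n l) >= 2. *)
Lemma large_sample_rate (X : samples l n) : 2 * M <= n%:R * l%:R ->
  (forall A : 'M[R]_n, symm A -> (forall i, A i i = 0) -> rows_le (2 * M) A ->
    l%:R * mgf_lambda M (expR (- (6 * M))) * mgf_rate M (expR (- (6 * M))) * frob2 A <=
    2 * (n%:R ^+ 2 * ln (n%:R * l%:R * (4 * M + 5)) + ln (1 / delta)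
         + mgf_lambda M (expR (- (6 * M))) * n%:R * (2 + 4 * M)
         - mgf_lambda M (expR (- (6 * M))) *
           \sum_t contrast Jstar (expR (- (6 * M))) A (X t))
    + 2 * mgf_lambda M (expR (- (6 * M))) * mgf_rate M (expR (- (6 * M)))) ->
  l%:R * frob2 (estimate M X - Jstar) <= rate_constant M ^+ 2 * W.
Proof.
set kappa := expR _; set lam := mgf_lambda _ _; set c := mgf_rate _ _.
move=> nl dev; have n0 : (0 < n)%N by apply: ltnW.
have lam0 : 0 < lam := lam_gt0 M0; have c0 : 0 < c := c_gt0 M0.
have lam1 : lam <= 1 := lam_le1 M0; have c1 : c <= 1 := c_le1 M0.
have large : 2 * M <= (n * l)%:R by rewrite natrM.
set T := num_steps n l; have T0 : 0 < T%:R :> R := num_steps_gt0 R n0 l0.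
pose A k : 'M[R]_n := clip M (iterate M X k) - Jstar.
have AE k i j : A k i j = clip M (iterate M X k) i j - Jstar i j by exact: subr_mxE.
have As k : symm (A k).
  have [s _] := iterate_symm M X k => i j.
  by rewrite !AE (clip_symm M s i j) Js.
have Ad k i : A k i i = 0.
  have [_ d] := iterate_symm M X k.
  by rewrite AE (clip_diag M d) Jd subrr.
have Ar k : rows_le (2 * M) (A k).
  move=> i; have := clip_rows M0 (iterate M X k) i; have := JM i => h1 h2.
  apply: (@le_trans _ _ (\sum_j (`|clip M (iterate M X k) i j| + `|Jstar i j|))).
    by apply: ler_sum => j _; rewrite AE; apply: ler_normB.
  rewrite big_split /=; lra.
pose S (k : 'I_T) := \sum_t contrast Jstar kappa (A k) (X t).
pose U := 2 * (n%:R ^+ 2 * ln (n%:R * l%:R * (4 * M + 5)) + ln (1 / delta)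
         + lam * n%:R * (2 + 4 * M)) + 2 * lam * c.
have dk (k : 'I_T) : l%:R * lam * c * frob2 (A k) <= - (2 * lam * S k - U).
  by have := dev _ (As k) (Ad k) (Ar k); rewrite /U /S; lra.
have {dk} sumdev : l%:R * lam * c * \sum_(k < T) frob2 (A k) <=
    - (2 * lam * \sum_k S k - T%:R * U).
  rewrite -sumr_sub_cst_scaled mulr_sumr -sumrN; apply: ler_sum => k _; exact: dk.
have reg := average_contrast_ge X M0 n0 l0 Js Jd JM large.
have conv := estimate_error_le M X n0 l0 Jstar.
set err := frob2 (estimate M X - Jstar) in conv *.
have lc0 : 0 < lam * c by exact: mulr_gt0.
have bound : l%:R * lam * c * err <= 2 * lam * (M ^+ 2 / 4 + 36 + 16 * M ^+ 3) + U.
  rewrite -(ler_pM2l T0).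
  have llc : 0 <= l%:R * lam * c by rewrite -mulrA mulr_ge0 // ltW.
  have := ler_wpM2l llc conv; have := ler_wpM2l (ltW lam0) reg; rewrite -/T -/kappa.
  by move: sumdev; rewrite /S /A; lra.
have lnE : ln (n%:R * l%:R * (4 * M + 5)) <= ln (n%:R * l%:R) + (4 * M + 5).
  have nl0 : 0 < n%:R * l%:R :> R by apply: mulr_gt0; have := nR; have := lR; lra.
  have m5 : 0 < 4 * M + 5 by have := M0; lra.
  rewrite lnM ?posrE // lerD2l; exact: ltW (ln_sublinear m5).
set L := ln (n%:R * l%:R) in lnE.
set N := n%:R ^+ 2 : R.
have N4 : 4 <= N := n4.
have N0 : 0 <= N by lra.
have LL : 1 / 2 <= L := L_ge.
have hN : N <= 2 * (N * L) by have := ler_wpM2l N0 LL; lra.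
have NL : 2 <= N * L := main_ge.
have D0 : 0 <= ln (1 / delta) := D_ge0.
have m0 := ltW M0.
have nN : n%:R <= N by rewrite /N expr2; have := nR; nra.
set P := M ^+ 2 / 4 + 36 + 16 * M ^+ 3 in bound.
have P0 : 0 <= P by rewrite /P; have := exprn_ge0 2 m0; have := exprn_ge0 3 m0; lra.
have t1 : N * ln (n%:R * l%:R * (4 * M + 5)) <= N * L + 2 * (N * L) * (4 * M + 5).
  apply: le_trans (ler_wpM2l N0 lnE) _; rewrite mulrDr lerD2l.
  by apply: ler_wpM2r => //; lra.
have t2 : lam * n%:R * (2 + 4 * M) <= 2 * (N * L) * (2 + 4 * M).
  apply: ler_wpM2r; first lra.
  by rewrite -[leRHS]mul1r; apply: ler_pM => //; [exact: ltW|exact: le_trans nN hN].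
have t3 : lam * c <= N * L.
  by apply: (@le_trans _ _ 1); [apply: mulr_ile1 => //; exact: ltW|lra].
have t4 : lam * P <= N * L * P.
  by apply: ler_wpM2r => //; apply: le_trans lam1 _; lra.
set y := expR M.
have py : 104 + 32 * M + M ^+ 2 / 2 + 32 * M ^+ 3 <= 104 * y ^+ 3 := poly_le_exp3 M0.
have y2 : 2 <= 104 * y ^+ 3.
  by have := exprn_ge0 2 m0; have := exprn_ge0 3 m0; lra.
have final : l%:R * lam * c * err <= 104 * y ^+ 3 * W.
  apply: (le_trans bound).
  have q1 := ler_wpM2r (_ : 0 <= N * L) py; have {}q1 := q1 (ltac:(lra)).
  have q2 := ler_wpM2r D0 y2.
  rewrite /W /U -/N -/L mulrDr; move: q1 t4; rewrite /P; lra.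
have rc := ler_wpM2r rate_ge0 (lam_c_rate M0); rewrite -/y -/lam -/c -/kappa in rc.
rewrite -(ler_pM2l lc0) mulrA.
have -> : lam * c * (rate_constant M ^+ 2 * W) = lam * c * rate_constant M ^+ 2 * W by ring.
by apply: le_trans rc; move: final; have -> : l%:R * lam * c = lam * c * l%:R by ring.
Qed.

End Rate.

End Assembly.

Theorem corollary6 (R : realType) :
  exists C : R -> R, singly_exponential C /\
  exists Jhat : forall n l : nat, R -> R -> samples l n -> 'M[R]_n,
    poly_time_computable Jhat /\
    forall (M delta : R) (n l : nat),
      0 < M -> 0 < delta < 1 -> (0 < n)%N -> (0 < l)%N ->
      (forall X : samples l n, bounded_interaction M (Jhat n l M delta X)) /\
      forall Jstar : 'M[R]_n, bounded_interaction M Jstar ->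
        1 - delta <=
        iid_ising_prob Jstar (fun X : samples l n =>
          frobenius (Jhat n l M delta X - Jstar) <=
          C M * Num.sqrt ((n%:R ^+ 2 * ln (n%:R * l%:R) + ln (1 / delta))
                          / l%:R)).
Proof.
exists (@rate_constant R); split; first exact: rate_constant_singly_exponential.
exists (fun n l M _ X => estimate M X); split; first exact: estimate_poly_time.
move=> M delta n l M0 delta01 n0 l0; have m0 := ltW M0.
split=> [X|Jstar].
  apply/bounded_interactionP => //; split.
  - exact: estimate_symm.
  - exact: estimate_diag.
  - exact: estimate_rows.
move=> /(bounded_interactionP _ m0)[Js Jd Jr].
have C0 : 0 <= rate_constant M.
  by apply: mulr_ge0; [exact: exprn_ge0|exact: expR_ge0].
have lR : 0 < l%:R :> R by rewrite ltr0n.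
have sure (E : pred (samples l n)) : (forall X, E X) -> 1 - delta <= iid_ising_prob Jstar E.
  move=> EX; have -> : iid_ising_prob Jstar E = 1.
    by rewrite -(iid_weight_sum1 l Jstar); apply: eq_bigl => X; rewrite EX.
  by case/andP: delta01 => ? ?; lra.
move: (n0); rewrite leq_eqVlt => /orP[/eqP n1|n2].
  (* A 1 x 1 interaction matrix is zero; log (n l) may vanish in this case. *)
  apply: sure => X; have -> : frobenius (estimate M X - Jstar) = 0.
    rewrite frobeniusE /frob2 big1 ?sqrtr0 // => i _; rewrite big1 // => j _.
    have -> : j = i by move: i j; rewrite -n1 => i j; rewrite !ord1.
    by rewrite subr_mxE Jd estimate_diag subr0 expr0n.
  by rewrite mulr_ge0 ?sqrtr_ge0.
have W0 := rate_ge0 delta01 n2 l0.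
have [nl|nl] := ltP (n%:R * l%:R) (2 * M).
  apply: sure => X; apply: frobenius_le => //.
  apply: small_sample_rate => // i.
  apply: (@le_trans _ _ (\sum_j (`|estimate M X i j| + `|Jstar i j|))).
    by apply: ler_sum => j _; rewrite subr_mxE; apply: ler_normB.
  by rewrite big_split /=; have := estimate_rows X M0 n0 l0 i; have := Jr i; lra.
have /andP[d0 _] := delta01.
have [E [PE HE]] := uniform_deviation Js Jd Jr M0 (kappa_gt0 M) (kappa_le1 M0) d0 (ltnW n2) l0.
apply: le_trans PE _; apply: iid_ising_prob_mono => X EX.
by apply: frobenius_le => //; apply: large_sample_rate => // A; apply: HE.
Qed.
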